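(* 1. (Symmetric binary perceptron, SBP.) For every $\kappa>0$ there exists $\tilde\alpha_o(\kappa)>0$ such that whenever $0<\alpha<\tilde\alpha_o(\kappa)$, with high probability there exists a cluster of the SBP solution space $\tilde S(G)$ of diameter $n$. 2. (Asymmetric binary perceptron, ABP.) For every $\kappa\in\mathbb{R}$ and every $\varepsilon>0$ there exists $\alpha_o(\kappa,\varepsilon)>0$ such that whenever $0<\alpha<\alpha_o(\kappa,\varepsilon)$, with high probability there exists a cluster of the ABP solution space $S(G)$ of diameter at least $(1-\varepsilon)n$.
   Context: Let $\alpha>0$ and $m=\lfloor\alpha n\rfloor$. Let $G$ be a random $m\times n$ matrix with i.i.d. entries uniform on $\{+1,-1\}$. ABP model with parameter $\kappa\in\mathbb{R}$: the set of solutions is $$S(G)=\Big\{X\in\{-1,+1\}^n:\ \tfrac{1}{\sqrt n}\sum_{i=1}^n G_{j,i}X_i\ge\kappa\ \text{ for all } j=1,\dots,m\Big\}.$$ SBP model with parameter $\kappa>0$: the set of solutions is $$\tilde S(G)=\Big\{X\in\{-1,+1\}^n:\ \tfrac{1}{\sqrt n}\Big|\sum_{i=1}^n G_{j,i}X_i\Big|\le\kappa\ \text{ for all } j=1,\dots,m\Big\}.$$ Two solutions are adjacent if they differ in exactly one coordinate. A cluster is a maximal connected component of the solution set ($S(G)$ for ABP, $\tilde S(G)$ for SBP) under this adjacency. The diameter of a cluster is the maximum Hamming distance between two of its elements. ''With high probability'' means with probability tending to $1$ as $n\to\infty$, with $\kappa,\alpha$ (and $\varepsilon$) fixed. *)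

(* Defs.v *)
From HB Require Import structures.
From mathcomp Require Import all_boot all_order all_algebra.
From mathcomp Require Import all_classical all_reals all_analysis.

Set Implicit Arguments.
Unset Strict Implicit.
Unset Printing Implicit Defensive.

Import Order.TTheory GRing.Theory Num.Theory.
Import numFieldNormedType.Exports.

Local Open Scope classical_set_scope.
Local Open Scope ring_scope.

(* The two-point set {+1, -1} is encoded by bool: true is +1, false is -1. *)
Definition spin {R : pzRingType} (b : bool) : R := if b then 1 else -1.

Notation cube n := {ffun 'I_n -> bool}.

Definition hamming {n : nat} (X Y : cube n) : nat :=
  #|[set i : 'I_n | X i != Y i]%SET|.

Definition margin {R : realType} {m n : nat} (G : 'M[bool]_(m, n))
    (X : cube n) (j : 'I_m) : R :=
  (Num.sqrt n%:R)^-1 * \sum_(i < n) spin (G j i) * spin (X i).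

Definition abp_solutions {R : realType} (kappa : R) {m n : nat}
    (G : 'M[bool]_(m, n)) : {set cube n} :=
  [set X : cube n | [forall j : 'I_m, kappa <= margin G X j]]%SET.

(* Since (sqrt n)^-1 >= 0, |margin| is (sqrt n)^-1 * |sum|. *)
Definition sbp_solutions {R : realType} (kappa : R) {m n : nat}
    (G : 'M[bool]_(m, n)) : {set cube n} :=
  [set X : cube n | [forall j : 'I_m, `|margin G X j| <= kappa]]%SET.

Definition adjacent_in {n : nat} (A : {set cube n}) : rel (cube n) :=
  fun X Y => [&& X \in A, Y \in A & hamming X Y == 1%N].

Definition connected_set {n : nat} (A : {set cube n}) : bool :=
  (A != finset.set0) &&
  [forall X in A, forall Y in A, connect (adjacent_in A) X Y].

Definition is_cluster {n : nat} (S C : {set cube n}) : bool :=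
  maxset (fun A : {set cube n} => (A \subset S) && connected_set A) C.

Definition diameter {n : nat} (C : {set cube n}) : nat :=
  \max_(X in C) \max_(Y in C) hamming X Y.

Definition uniform_spin (R : realType) (b : bool) : R := #|{: bool}|%:R^-1.

(* Probability of the event E for a matrix with i.i.d. uniform spin entries:
   the law of the matrix is the product of the laws of its entries. *)
Definition Prob (R : realType) {m n : nat} (E : pred 'M[bool]_(m, n)) : R :=
  \sum_(G : 'M[bool]_(m, n) | E G)
    \prod_(j < m) \prod_(i < n) uniform_spin R (G j i).

(* truncn is the natural-number floor for nonnegative arguments. *)
Definition nb_constraints {R : realType} (alpha : R) (n : nat) : nat :=
  Num.truncn (alpha * n%:R).

Definition with_high_probability {R : realType} (alpha : R)
    (E : forall n : nat, pred 'M[bool]_(nb_constraints alpha n, n)) : Prop :=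
  (fun n : nat => Prob R (E n)) @ \oo --> (1 : R).
Arguments with_high_probability {R} alpha E.

(* Main.v *)
(** Both parts rest on a deterministic prefix discrepancy bound: for every [m] x [s]
    matrix with entries in [[-1, 1]] there are signs for which all prefix sums of the
    signed columns are at most [C (m s)^(1/4)] in every row. When [m <= alpha n] and
    [s <= n] this is at most [C alpha^(1/4) sqrt n], an arbitrarily small multiple of
    [sqrt n]. It is obtained by iterating an entropy (pigeonhole) partial coloring
    applied to the sums over dyadic blocks.

    SBP: if [X] is such a coloring of the columns of [G], flipping the coordinates of
    [X] one after the other leads from [X] to [-X], and all intermediate margins are
    combinations of two prefix sums. Hence every [G] works when [alpha] is small.

    ABP: a set [A] of about [delta n] columns is used to produce large margins, and
    the remaining columns are colored by the prefix bound and then flipped one by one,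
    which perturbs the margins only slightly. On [A], with high probability
    [|G_A^T y|_1 >= c n |y|_2] for all [y >= 0]; by duality there is a fractional
    [x] in [[-1, 1]^A] with all margins at least [K], and [x] is rounded to signs one
    binary digit at a time, again by the discrepancy bound. *)
Require Import Defs.
From mathcomp Require Import all_boot all_order all_algebra.
From mathcomp Require Import all_classical all_reals all_analysis.
From mathcomp Require Import ring lra zify.

Import Order.TTheory GRing.Theory Num.Theory.
Import numFieldNormedType.Exports.

Local Open Scope ring_scope.

Set Implicit Arguments.
Unset Strict Implicit.

(** * Means over finite cubes *)

Definition mean {R : realType} {Om : finType} (f : Om -> R) : R :=
  #|Om|%:R^-1 * \sum_x f x.

Section Mean.
Variables (R : realType) (Om : finType).
Implicit Types (f g : Om -> R) (k : R).

Lemma meanD f g : mean (fun x => f x + g x) = mean f + mean g.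
Proof. by rewrite /mean big_split mulrDr. Qed.

Lemma meanZ k f : mean (fun x => k * f x) = k * mean f.
Proof. by rewrite /mean -mulr_sumr mulrCA. Qed.

Lemma le_mean f g : (forall x, f x <= g x) -> mean f <= mean g.
Proof.
by move=> fg; rewrite /mean ler_wpM2l ?invr_ge0 ?ler0n// ler_sum.
Qed.

Lemma eq_mean f g : (forall x, f x = g x) -> mean f = mean g.
Proof. by move=> fg; rewrite /mean (eq_bigr g). Qed.

Lemma mean_cst k : (0 < #|Om|)%N -> mean (fun _ : Om => k) = k :> R.
Proof.
move=> Om0; rewrite /mean sumr_const -[k *+ _]mulr_natl mulrA mulVf ?mul1r//.
by rewrite pnatr_eq0 -lt0n.
Qed.

Lemma mean_sum (I : Type) (r : seq I) (P : pred I) (F : I -> Om -> R) :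
  mean (fun x => \sum_(i <- r | P i) F i x) = \sum_(i <- r | P i) mean (F i).
Proof. by rewrite /mean exchange_big mulr_sumr. Qed.

End Mean.

Lemma mean_prod (R : realType) (T Om : finType) (F : T -> Om -> R) :
  mean (fun X : {ffun T -> Om} => \prod_i F i (X i)) = \prod_i mean (F i).
Proof.
rewrite /mean big_split /= prodr_const card_ffun natrX exprVn.
by congr (_ * _); rewrite bigA_distr_bigA.
Qed.

Lemma card_cube_gt0 (T : finType) : (0 < #|{: {ffun T -> bool}}|)%N.
Proof. by rewrite card_ffun card_bool expn_gt0. Qed.

Lemma mean_bool (R : realType) (f : bool -> R) :
  mean f = (f true + f false) / 2.
Proof. by rewrite /mean card_bool big_bool mulrC. Qed.

Definition flip {T : finType} (i : T) (X : {ffun T -> bool}) : {ffun T -> bool} :=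
  [ffun k => (k == i) (+) X k].

Lemma flipK (T : finType) (i : T) : involutive (flip i).
Proof. by move=> X; apply/ffunP => k; rewrite !ffunE addKb. Qed.

(** Reindexing by the involution [flip i] changes the sign of the sum, so the sum is its own
    opposite. *)
Lemma mean_flip (R : realType) (T : finType) (i : T)
    (f : {ffun T -> bool} -> R) :
  (forall X, f (flip i X) = f X) -> mean (fun X => f X * spin (X i)) = 0.
Proof.
move=> fi; rewrite /mean.
set S := \sum_x _; suff : S = - S by move=> ?; rewrite (_ : S = 0) ?mulr0//; lra.
rewrite {1}/S (reindex_inj (inv_inj (@flipK T i))) -sumrN /=.
apply: eq_bigr => X _; rewrite fi ffunE eqxx.
by case: (X i); rewrite /= /spin; ring.
Qed.

(** * Moments of random signed sums *)

Section Moments.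
Variables (R : realType) (T : finType) (a : T -> R).

Let A r (X : {ffun T -> bool}) := \sum_(i <- r) a i * spin (X i) : R.
Let L r : R := \sum_(i <- r) a i ^+ 2.

(** Induction on [r]: odd powers of the new sign average to 0 by [mean_flip], and the remaining
    terms are dominated one by one by those of [3 * (a i ^+ 2 + L r) ^+ 2] and
    [15 * (a i ^+ 2 + L r) ^+ 3]. The constants 3 and 15 are the Gaussian moments. *)
Lemma moments r : uniq r ->
  [/\ mean (fun X => A r X ^+ 2) = L r,
      mean (fun X => A r X ^+ 4) <= 3 * L r ^+ 2 &
      mean (fun X => A r X ^+ 6) <= 15 * L r ^+ 3].
Proof.
elim: r => [_|i r IH /= /andP[ir /IH[E2 E4 E6]]].
  by rewrite /L /A !big_nil; split; under eq_mean do rewrite big_nil expr0n;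
    rewrite ?mean_cst ?card_cube_gt0// expr0n mulr0.
have Ei X : A r (flip i X) = A r X.
  apply: eq_big_seq => k kr; rewrite ffunE (_ : k == i = false)//.
  by apply: contraNF ir => /eqP <-.
have odd k : mean (fun X => A r X ^+ k * spin (X i)) = 0.
  by apply: mean_flip => X; rewrite Ei.
have AE X : A (i :: r) X = a i * spin (X i) + A r X by rewrite /A big_cons.
have LE : L (i :: r) = a i ^+ 2 + L r by rewrite /L big_cons.
have L0 : 0 <= L r by apply: sumr_ge0 => *; exact: sqr_ge0.
have u0 : 0 <= a i ^+ 2 by exact: sqr_ge0.
rewrite LE; set u := a i in AE LE u0 *.
have E1 : mean (fun _ : {ffun T -> bool} => 1) = 1 :> R.
  by rewrite mean_cst ?card_cube_gt0.
split.
- rewrite (eq_mean (g := fun X => A r X ^+ 2 +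
     (2 * u * (A r X ^+ 1 * spin (X i)) + u ^+ 2 * 1))); last first.
    by move=> X; rewrite AE /spin; case: (X i); ring.
  rewrite !meanD !meanZ odd E2 E1; ring.
- rewrite (eq_mean (g := fun X => A r X ^+ 4 +
     (4 * u * (A r X ^+ 3 * spin (X i)) + (6 * u ^+ 2 * A r X ^+ 2 +
      (4 * u ^+ 3 * (A r X ^+ 1 * spin (X i)) + u ^+ 4 * 1))))); last first.
    by move=> X; rewrite AE /spin; case: (X i); ring.
  rewrite !meanD !meanZ !odd E2 E1.
  have := mulr_ge0 u0 L0; have := mulr_ge0 u0 u0; nra.
- rewrite (eq_mean (g := fun X => A r X ^+ 6 +
     (6 * u * (A r X ^+ 5 * spin (X i)) + (15 * u ^+ 2 * A r X ^+ 4 +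
      (20 * u ^+ 3 * (A r X ^+ 3 * spin (X i)) + (15 * u ^+ 4 * A r X ^+ 2 +
      (6 * u ^+ 5 * (A r X ^+ 1 * spin (X i)) + u ^+ 6 * 1))))))); last first.
    by move=> X; rewrite AE /spin; case: (X i); ring.
  rewrite !meanD !meanZ !odd E2 E1.
  have -> : u ^+ 4 = u ^+ 2 * u ^+ 2 by ring.
  have -> : u ^+ 6 = u ^+ 2 * u ^+ 2 * u ^+ 2 by ring.
  move: u0 E4; set v := u ^+ 2 => u0 E4.
  have H1 := ler_wpM2l u0 E4.
  have H2 := mulr_ge0 (mulr_ge0 u0 u0) L0.
  have H3 := mulr_ge0 (mulr_ge0 u0 u0) u0.
  have -> : 15 * (v + L r) ^+ 3 = 15 * L r ^+ 3 + 15 * (v * (3 * L r ^+ 2)) +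
     45 * (v * v * L r) + 15 * (v * v * v) by ring.
  by lra.
Qed.
End Moments.

(** * Partial coloring *)

(** Telescoping against 2 minus the inverse of the last index; the term [k = 0] vanishes because the
    inverse of 0 is 0. *)
Lemma sum_inv_sqr_le2 (R : realType) (N : nat) :
  \sum_(k < N) (k%:R ^+ 2)^-1 <= 2 :> R.
Proof.
case: N => [|N]; first by rewrite big_ord0.
case: N => [|N]; first by rewrite big_ord1 expr0n invr0.
suff : \sum_(k < N.+2) (k%:R ^+ 2)^-1 <= 2 - N.+1%:R^-1 :> R.
  by move=> /le_trans; apply; rewrite gerBl invr_ge0 ler0n.
elim: N => [|N IH].
  by rewrite !big_ord_recr big_ord0 /= expr0n invr0 expr1n invr1; lra.
rewrite big_ord_recr /=; apply: (le_trans (lerD IH (lexx _))).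
have x0 : 0 < N.+1%:R :> R by rewrite ltr0n.
rewrite -[N.+2%:R]natr1; set x := N.+1%:R in x0 *.
have x1 : 0 < x + 1 by lra.
rewrite -subr_ge0.
have -> : 2 - (x + 1)^-1 - (2 - x^-1 + (x + 1) ^- 2) = (x * (x + 1) ^+ 2)^-1.
  by field; rewrite !gt_eqF.
by rewrite invr_ge0 mulr_ge0 ?sqr_ge0// ltW.
Qed.

(** Chernoff bound for a Hamming ball of radius [#|T| / 10]. Each coordinate contributes [(1 + exp
    (-1)) / 2 <= 3 / 4 <= exp (- 1 / 4)], and [1 / 10 - 1 / 4 = - 15 / 100]. *)
Lemma mean_near (R : realType) (T : finType) (X : {ffun T -> bool}) :
  mean (fun Y : {ffun T -> bool} =>
    ((10 * #|[set i | X i != Y i]%SET| < #|T|)%N : nat)%:R)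
  <= expR (- (15 / 100) * #|T|%:R) :> R.
Proof.
pose s : R := #|T|%:R.
apply: (@le_trans _ _ (mean (fun Y : {ffun T -> bool} =>
   expR (s / 10) * \prod_i expR (- ((X i != Y i) : nat)%:R)))).
  apply: le_mean => Y; rewrite -expR_sum -expRD.
  case: ltnP => [h|_]; last exact: expR_ge0.
  apply: le_trans (expR_ge1Dx _); rewrite lerDl.
  rewrite sumrN -natr_sum -[X in _ - X%:R]/(\sum_i _)%N.
  have -> : (\sum_i (X i != Y i) = #|[set i | X i != Y i]%SET|)%N.
    by rewrite -sum1dep_card [RHS]big_mkcond /=; apply: eq_bigr => i _; case: (_ != _).
  move: h; rewrite -(ltr_nat R) natrM -/s => h; lra.
rewrite meanZ (mean_prod (fun i b => expR (- ((X i != b) : nat)%:R))).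
have e1 : expR (-1) <= 2^-1 :> R.
  rewrite expRN lef_pV2 ?posrE ?expR_gt0//.
  by have := expR_ge1Dx (1 : R); lra.
have h : \prod_i mean (fun b => expR (- ((X i != b) : nat)%:R)) <=
    \prod_(i in T) expR (- (1 / 4)) :> R.
  apply: ler_prod => i _; rewrite mean_bool; apply/andP; split.
    by rewrite divr_ge0// addr_ge0// expR_ge0.
  apply: (@le_trans _ _ (3 / 4)).
    by case: (X i); rewrite /= oppr0 expR0; lra.
  by have := expR_ge1Dx (- (1 / 4) : R); lra.
apply: (le_trans (ler_wpM2l (expR_ge0 _) h)).
rewrite prodr_const -expRM_natl -expRD -/s ler_expR -[_ *+ _]mulr_natl -/s.
have := ler0n R #|T|; rewrite -/s; lra.
Qed.

Lemma inv_ge_expRN (R : realType) (v : R) : 0 < v -> expR (- v) <= v^-1.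
Proof.
move=> v0; rewrite expRN lef_pV2 ?posrE ?expR_gt0//.
by have := expR_ge1Dx v; lra.
Qed.

(** Jensen's inequality, through the tangent line of the exponential at [- mu]. *)
Lemma mean_expRN_ge (R : realType) (Om : finType) (f : Om -> R) (mu : R) :
  (0 < #|Om|)%N -> mean f <= mu -> expR (- mu) <= mean (fun x => expR (- f x)).
Proof.
move=> Om0 fmu.
apply: (@le_trans _ _ (mean (fun x => expR (- mu) * (1 + mu) +
   (- expR (- mu)) * f x))).
  rewrite meanD !meanZ mean_cst//.
  by have := ler_wpM2l (expR_ge0 (- mu)) fmu; lra.
apply: le_mean => x.
have -> : expR (- f x) = expR (- mu) * expR (mu - f x).
  by rewrite -expRD; congr expR; ring.
have := ler_wpM2l (expR_ge0 (- mu)) (expR_ge1Dx (mu - f x)); lra.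
Qed.

Section PartialColoring.
Variables (R : realType) (T C : finType) (a : C -> T -> R) (D : C -> R).
Hypothesis D0 : forall c, 0 < D c.

Let V c (X : {ffun T -> bool}) : R := \sum_i a c i * spin (X i).
Let L c : R := \sum_i a c i ^+ 2.
Let tau c : R := L c ^+ 2 / D c ^+ 4.
(** Bounds every integer part that can occur, so that the code alphabet [Z] is finite. *)
Let M := (\max_(p : C * {ffun T -> bool}) Num.truncn (`|V p.1 p.2| / D p.1))%N.
Let Z : finType := option (bool * 'I_M.+1).

Let code c X : Z :=
  if `|V c X| < D c then None
  else Some (0 < V c X, inord (Num.truncn (`|V c X| / D c))).

(** Weights in place of entropies: over the alphabet they add up to at most [1 + 4 * tau c], while
    the logarithm of the weight of a random code has mean at least [- 30 * tau c]. *)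
Let w c (z : Z) : R := if z is Some (_, k) then tau c / k%:R ^+ 2 else 1.

Let L0 c : 0 <= L c. Proof. by apply: sumr_ge0 => *; exact: sqr_ge0. Qed.
Let tau0 c : 0 <= tau c.
Proof. by rewrite divr_ge0 ?sqr_ge0// exprn_ge0// ltW. Qed.

Let code_val c X : ((inord (Num.truncn (`|V c X| / D c)) : 'I_M.+1) : nat) =
  Num.truncn (`|V c X| / D c).
Proof.
rewrite inordK// ltnS /M.
exact: (leq_bigmax (F := fun p => Num.truncn (`|V p.1 p.2| / D p.1)) (c, X)).
Qed.

(** The class [None] is an interval of length [2 * D c]; any other class fixes the sign of [V] and
    the integer part of [|V| / D c], so its length is at most [D c]. *)
Let codeP c X Y : code c X = code c Y -> `|V c X - V c Y| <= 2 * D c.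
Proof.
rewrite /code; case: (ltP `|V c X|) => hX.
  case: (ltP `|V c Y|) => hY // _.
  by move: hX hY; rewrite !ltr_norml ler_norml => /andP[] ? ? /andP[] ? ?; lra.
case: (ltP `|V c Y|) => hY //.
move=> /Some_inj/eqP; rewrite xpair_eqE => /andP[/eqP sXY /eqP/(congr1 val)].
rewrite /= !code_val => kXY.
have D0c := D0 c.
have bnd X' : exists2 r : R, `|V c X'| = ((Num.truncn (`|V c X'| / D c))%:R + r) * D c &
    0 <= r < 1.
  have := truncn_itv (divr_ge0 (normr_ge0 (V c X')) (ltW D0c)).
  move=> /andP[h1 h2]; exists (`|V c X'| / D c - (Num.truncn (`|V c X'| / D c))%:R).
    by field; rewrite gt_eqF.
  by rewrite -natr1 in h2; apply/andP; split; lra.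
have [r eX /andP[r0 r1]] := bnd X; have [r' eY /andP[r0' r1']] := bnd Y.
rewrite -kXY in eY.
have h : `| `|V c X| - `|V c Y| | <= D c.
  rewrite eX eY (_ : _ - _ = (r - r') * D c); last by ring.
  rewrite normrM (gtr0_norm D0c) ler_piMl ?(ltW D0c)// ler_norml; apply/andP; split; lra.
move: sXY h; case: (ltP 0 (V c X)) => pX /esym.
  by move=> pY; rewrite (gtr0_norm pX) (gtr0_norm pY) => h; lra.
move=> /negbT; rewrite -leNgt => pY.
rewrite (ler0_norm pX) (ler0_norm pY) -normrN.
by rewrite (_ : - (- V c X - - V c Y) = V c X - V c Y); [lra|ring].
Qed.

(** Outside [None], both [D] and [k * D] are at most [|V|], so the weight is at least
    [L ^ 2 / V ^ 4 = v ^ (-2)] with [v = V ^ 2 / L]. This is at least [exp (- 2 v)], and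
    [(V / D) ^ 4 >= 1] may be inserted in the exponent. The sixth power is what [moments]
    averages. *)
Let w_code c X : expR (- (2 / (L c * D c ^+ 4) * V c X ^+ 6)) <= w c (code c X).
Proof.
have D0c := D0 c.
have V60 : 0 <= V c X ^+ 6 by rewrite (_ : 6 = 3 * 2)%N// exprM sqr_ge0.
rewrite /code; case: (ltP `|V c X|) => hX /=.
  by rewrite expR_le1 oppr_le0 mulr_ge0// divr_ge0// mulr_ge0// exprn_ge0// ltW.
rewrite code_val.
have Vn0 : V c X != 0 by rewrite -normr_gt0; apply: lt_le_trans hX.
have Lp : 0 < L c.
  rewrite lt0r L0 andbT; apply: contra Vn0 => /eqP Lc0; rewrite /V big1// => i _.
  have /eqP := psumr_eq0P (fun i _ => sqr_ge0 (a c i)) Lc0 (i := i) isT.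
  by rewrite sqrf_eq0 => /eqP ->; rewrite mul0r.
set k := Num.truncn _.
have ku : k%:R <= `|V c X| / D c by rewrite truncn_le divr_ge0// ltW.
have k0 : (0 < k)%N by rewrite truncn_gt0 ler_pdivlMr// mul1r.
set x := V c X in Vn0 hX V60 ku *.
have x2 : D c ^+ 2 <= x ^+ 2.
  by rewrite -(real_normK (num_real x)) ler_sqr ?nnegrE// ltW.
have xp : 0 < x ^+ 2 by rewrite exprn_even_gt0.
have Dp : 0 < D c ^+ 2 by rewrite exprn_gt0.
have kp : 0 < k%:R ^+ 2 :> R by rewrite exprn_gt0// ltr0n.
have k2 : k%:R ^+ 2 * D c ^+ 2 <= x ^+ 2.
  rewrite -exprMn -(real_normK (num_real x)) ler_sqr ?nnegrE//.
    by rewrite -ler_pdivlMr.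
  by rewrite mulr_ge0// ltW.
pose v := x ^+ 2 / L c.
have v0 : 0 < v by rewrite divr_gt0.
apply: (@le_trans _ _ (v^-1 ^+ 2)).
  apply: (@le_trans _ _ (expR (- v) ^+ 2)); last first.
    by rewrite ler_sqr ?nnegrE ?expR_ge0 ?invr_ge0 ?inv_ge_expRN// ltW.
  rewrite -expRM_natl ler_expR.
  have -> : 2 / (L c * D c ^+ 4) * x ^+ 6 = 2 * v * (x ^+ 2 / D c ^+ 2) ^+ 2.
    by rewrite /v; field; rewrite !gt_eqF.
  have : 1 <= (x ^+ 2 / D c ^+ 2) ^+ 2.
    by rewrite exprn_ege1// ler_pdivlMr// mul1r.
  move=> /(ler_wpM2l (ltW v0)); lra.
rewrite /tau /v.
have -> : (x ^+ 2 / L c)^-1 ^+ 2 = L c ^+ 2 / (x ^+ 2 * x ^+ 2).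
  by field; rewrite Vn0 gt_eqF.
have -> : L c ^+ 2 / D c ^+ 4 / k%:R ^+ 2 = L c ^+ 2 / (D c ^+ 2 * (k%:R ^+ 2 * D c ^+ 2)).
  by field; rewrite !gt_eqF ?ltr0n.
have kD : 0 < k%:R ^+ 2 * D c ^+ 2 by exact: mulr_gt0.
have kD2 := mulr_gt0 Dp kD; have xx := mulr_gt0 xp xp.
rewrite ler_wpM2l ?sqr_ge0// lef_pV2 ?posrE//.
by apply: ler_pM => //; exact: ltW.
Qed.

Let sum_w : \sum_(b : {ffun C -> Z}) \prod_c w c (b c) <= expR (4 * \sum_c tau c).
Proof.
rewrite -(bigA_distr_bigA w) mulr_sumr expR_sum; apply: ler_prod => c _.
apply/andP; split.
  apply: sumr_ge0 => -[[? k]|] _ //=.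
  by rewrite divr_ge0// sqr_ge0.
apply: le_trans (expR_ge1Dx _).
rewrite (bigD1 None) //= lerD2l (reindex_omap Some id) /=; last by case.
rewrite (eq_big predT (fun p : bool * 'I_M.+1 => tau c / p.2%:R ^+ 2)); first last.
- by case.
- by move=> p; rewrite /= eqxx.
rewrite -(pair_bigA _ (fun (_ : bool) (k : 'I_M.+1) => tau c / k%:R ^+ 2)) /=.
rewrite big_bool /= -!mulr_sumr.
have := ler_wpM2l (tau0 c) (sum_inv_sqr_le2 R M.+1); lra.
Qed.

(* Entropy method: the codes of the constraints take few values, so some class
   of colorings with equal codes exceeds a Hamming ball of radius [#|T| / 10],
   and contains two colorings far apart. *)
Lemma partial_coloring :
  (0 < #|T|)%N ->
  \sum_c (\sum_i a c i ^+ 2) ^+ 2 / D c ^+ 4 <= #|T|%:R / 300 ->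
  exists X Y : {ffun T -> bool},
    (#|T| <= 10 * #|[set i | X i != Y i]%SET|)%N /\
    forall c, `|\sum_i a c i * spin (X i) - \sum_i a c i * spin (Y i)| <= 2 * D c.
Proof.
move=> T0; rewrite -[\sum_c _]/(\sum_c tau c) => Q.
pose cd X : {ffun C -> Z} := [ffun c => code c X].
case: (boolP [exists X, [exists Y, (cd X == cd Y) &&
    (#|T| <= 10 * #|[set i | X i != Y i]%SET|)%N]]).
  move=> /existsP[X /existsP[Y /andP[/eqP eXY far]]]; exists X, Y; split=> // c.
  by apply: codeP; have := congr1 (fun f : {ffun C -> Z} => f c) eXY; rewrite !ffunE.
rewrite negb_exists => /forallP near.
have near' X Y : cd X = cd Y -> (10 * #|[set i | X i != Y i]%SET| < #|T|)%N.
  move=> eXY; have := near X; rewrite negb_exists => /forallP/(_ Y).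
  by rewrite eXY eqxx /= -ltnNge.
(* Jensen with the sixth moment: [2 / (L * D ^ 4)] times [15 * L ^ 3] is [30 * tau]. *)
have low : expR (- (30 * \sum_c tau c)) <= mean (fun X => \prod_c w c (cd X c)).
  apply: (@le_trans _ _ (mean (fun X => expR (- \sum_c 2 / (L c * D c ^+ 4) * V c X ^+ 6)))).
    apply: mean_expRN_ge; first exact: card_cube_gt0.
    rewrite mean_sum mulr_sumr; apply: ler_sum => c _; rewrite meanZ.
    have [_ _] := moments (a c) (index_enum_uniq T).
    rewrite -/(L c) => h.
    have h0 : 0 <= 2 / (L c * D c ^+ 4) by rewrite divr_ge0// mulr_ge0// exprn_ge0// ltW.
    apply: (le_trans (ler_wpM2l h0 h)); rewrite /tau.
    have [->|Ln0] := eqVneq (L c) 0; first by rewrite !expr0n /= !mulr0 !mul0r mulr0.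
    rewrite le_eqVlt; apply/orP; left; apply/eqP.
    by field; rewrite Ln0 gt_eqF.
  apply: le_mean => X; rewrite -sumrN expR_sum; apply: ler_prod => c _.
  by rewrite expR_ge0 ffunE; exact: w_code.
have W0 b : 0 <= \prod_c w c (b c).
  apply: prodr_ge0 => c _; rewrite /w; case: (b c) => [[_ k]|//].
  by rewrite divr_ge0 ?sqr_ge0.
(* Sort the colorings by code: by [near'] each class lies in a small ball around any of its members,
   so [mean_near] bounds its density. *)
have up : mean (fun X => \prod_c w c (cd X c)) <=
    expR (4 * \sum_c tau c) * expR (- (15 / 100) * #|T|%:R).
  rewrite (eq_mean (g := fun X => \sum_(b : {ffun C -> Z})
      (\prod_c w c (b c)) * ((cd X == b) : nat)%:R)); last first.
    move=> X; rewrite (bigD1 (cd X)) //= eqxx mulr1 [X in _ + X]big1 ?addr0// => b bX.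
    by rewrite eq_sym (negbTE bX) mulr0.
  rewrite mean_sum; apply: le_trans (ler_wpM2r (expR_ge0 _) sum_w).
  rewrite mulr_suml; apply: ler_sum => b _; rewrite meanZ ler_wpM2l//.
  case: (pickP [pred X | cd X == b]) => [X0 /eqP X0b|nob]; last first.
    rewrite (eq_mean (g := fun _ => 0)); last by move=> X; have /= -> := nob X.
    by rewrite mean_cst ?card_cube_gt0// expR_ge0.
  apply: le_trans (mean_near R X0); apply: le_mean => X; rewrite ler_nat.
  by case: eqP => // Xb; rewrite near'// X0b Xb.
(* Contradiction, since [(30 + 4) / 300 < 15 / 100]. *)
have := le_trans low up; rewrite -expRD ler_expR.
have : 0 < #|T|%:R :> R by rewrite ltr0n.
by move: Q; lra.
Qed.

End PartialColoring.

(** * Prefix discrepancy *)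

Definition root4 {R : realType} (x : R) : R := Num.sqrt (Num.sqrt x).

Section Root4.
Variable R : realType.
Implicit Types x y c : R.

Lemma root4_ge0 x : 0 <= root4 x. Proof. exact: sqrtr_ge0. Qed.

Lemma root4_gt0 x : 0 < x -> 0 < root4 x.
Proof. by move=> x0; rewrite /root4 !sqrtr_gt0. Qed.

Lemma root4K x : 0 <= x -> root4 x ^+ 4 = x.
Proof. by move=> x0; rewrite (_ : 4 = 2 * 2)%N// exprM !sqr_sqrtr// sqrtr_ge0. Qed.

Lemma root4_le x y c : 0 <= c -> 0 <= y -> x <= c ^+ 4 * y -> root4 x <= c * root4 y.
Proof.
move=> c0 y0 xy.
have -> : c * root4 y = root4 (c ^+ 4 * y).
  rewrite /root4 sqrtrM ?exprn_ge0// (_ : 4 = 2 * 2)%N// exprM.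
  by rewrite sqrtr_sqr ger0_norm ?sqr_ge0// sqrtrM ?sqr_ge0// sqrtr_sqr ger0_norm.
by rewrite /root4 !ler_wsqrtr.
Qed.

End Root4.

(** The last hypothesis makes the bound [c] stable under [S -> 1 + x * S], which is how the sum
    grows with [K]. *)
Lemma sum_geometric_le (R : realType) (x c : R) (K : nat) :
  0 <= x -> 0 <= c -> 1 + x * c <= c -> \sum_(k < K.+1) x ^+ (K - k) <= c.
Proof.
move=> x0 c0 xc; elim: K => [|K IH].
  by rewrite big_ord1 subn0 expr0; have := mulr_ge0 x0 c0; lra.
rewrite big_ord_recr /= subnn expr0.
rewrite (eq_bigr (fun k : 'I_K.+1 => x * x ^+ (K - k))); last first.
  by move=> k _; rewrite -exprS subSn// -ltnS.
by rewrite -mulr_sumr; have := ler_wpM2l x0 IH; lra.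
Qed.

(** Follow the binary digits of [t] from the lowest: rounding [t] down from a multiple of [2 ^ k] to
    a multiple of [2 ^ k.+1] removes at most one block of length [2 ^ k]. *)
Lemma prefix_le_dyadic (R : realType) (s : nat) (f : 'I_s -> R) (B : nat -> R)
    (K t : nat) :
  (t < 2 ^ K)%N ->
  (forall k q, (k < K)%N -> `|\sum_(i < s | (i %/ 2 ^ k == q)%N) f i| <= B k) ->
  `|\sum_(i < s | (i < t)%N) f i| <= \sum_(k < K) B k.
Proof.
move=> tK fB.
pose P u := \sum_(i < s | (i < u)%N) f i.
suff H k : (k <= K)%N ->
    `|P t| <= \sum_(l < k) B l + `|P (t %/ 2 ^ k * 2 ^ k)%N|.
  have := H K (leqnn K); rewrite divn_small// mul0n.
  by rewrite [P 0]big1 ?normr0 ?addr0.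
elim: k => [|k IH] kK; first by rewrite big_ord0 add0r expn0 divn1 muln1.
apply: (le_trans (IH (ltnW kK))); rewrite big_ord_recr /= -addrA lerD2l.
have d0 : (0 < 2 ^ k)%N by rewrite expn_gt0.
have PE u : P (u * 2 ^ k)%N = \sum_(i < s | (i %/ 2 ^ k < u)%N) f i.
  by apply: eq_bigl => i; rewrite ltn_divLR.
set u := (t %/ 2 ^ k)%N.
have -> : (t %/ 2 ^ k.+1 * 2 ^ k.+1 = u./2.*2 * 2 ^ k)%N.
  by rewrite expnSr divnMA -/u divn2 -muln2 -mulnA [(2 * _)%N]mulnC.
have B0 : 0 <= B k by apply: le_trans (fB k 0%N kK).
rewrite !PE; have := odd_double_half u; case: (odd u) => /= uE; last first.
  by rewrite -uE add0n doubleK lerDr.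
set v := u./2.*2 in uE *; rewrite -uE add1n.
rewrite (bigID (fun i : 'I_s => i %/ 2 ^ k == v)%N) /=.
apply: (le_trans (ler_normD _ _)); apply: lerD.
  rewrite (eq_bigl (fun i : 'I_s => i %/ 2 ^ k == v)%N); first exact: fB.
  by move=> i; case: eqP => [->|]; rewrite ?ltnSn ?andbF.
by rewrite le_eqVlt; apply/orP; left; apply/eqP; congr `| _ |; apply: eq_bigl => i;
  rewrite ltnS andbC -ltn_neqAle.
Qed.

Lemma card_block (s d q : nat) : (0 < d)%N ->
  (\sum_(i < s) (i %/ d == q) <= d)%N.
Proof.
move=> d0.
rewrite -[X in (X <= _)%N](_ : (\sum_(i < s | i %/ d == q) 1)%N = _); last first.
  by rewrite big_mkcond; apply: eq_bigr => i _; case: eqP.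
rewrite sum1dep_card -[X in (_ <= X)%N]card_ord.
rewrite -(card_in_imset (f := fun i : 'I_s => Ordinal (ltn_pmod i d0))).
  exact: max_card.
move=> i k; rewrite !inE => /eqP iq /eqP kq /(congr1 val)/= ik.
by apply/val_inj; rewrite /= (divn_eq i d) (divn_eq k d) iq kq ik.
Qed.

Section PrefixColoring.
Variables (R : realType) (s m : nat) (h : 'I_m -> 'I_s -> R).
Hypothesis h1 : forall j i, `|h j i| <= 1.

Let Delta : R := root4 (1500 * m%:R * s%:R).

(* Blocks of length [2 ^ k] get the threshold [Delta * (9 / 10) ^ (K - k)]: these
   thresholds are summable over [k], while [2 * (9 / 10) ^ 4 > 1] makes the entropy
   budget a convergent geometric series dominated by the longest blocks. *)
Lemma partial_prefix_coloring : (0 < s)%N ->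
  exists X Y : {ffun 'I_s -> bool},
    (s <= 10 * #|[set i | X i != Y i]%SET|)%N /\
    forall j t, (t <= s)%N ->
      `|\sum_(i < s | (i < t)%N) h j i * ((spin (X i) - spin (Y i)) / 2)| <=
      10 * Delta.
Proof.
move=> s0.
case: (posnP m) => [m0|m0].
  exists [ffun=> true], [ffun=> false]; split.
    rewrite (_ : [set i | _]%SET = [set: 'I_s]%SET) ?cardsT ?card_ord ?leq_pmull//.
    by apply/setP => i; rewrite !inE !ffunE.
  by move=> j; have := ltn_ord j; rewrite {2}m0 ltn0.
pose K := trunc_log 2 s.
have [sK1 sK2] : (2 ^ K <= s)%N /\ (s < 2 ^ K.+1)%N.
  by split; [exact: trunc_logP|exact: trunc_log_ltn].
have ms0 : 0 < 1500 * m%:R * s%:R :> R by rewrite !mulr_gt0 ?ltr0n.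
have De0 : 0 < Delta by exact: root4_gt0.
(* One constraint per level, row and block number; the numbers of empty blocks give zero rows, which
   cost nothing. *)
pose C : finType := ('I_K.+1 * 'I_m * 'I_s)%type.
pose a (c : C) (i : 'I_s) : R := h c.1.2 i * ((i %/ 2 ^ c.1.1 == c.2)%N : nat)%:R.
pose D0 k : R := Delta * (9 / 10) ^+ (K - k).
pose D (c : C) : R := D0 c.1.1.
have D00 k : 0 < D0 k by rewrite mulr_gt0// exprn_gt0//; lra.
have Dgt0 c : 0 < D c by exact: D00.
pose nb (k q : nat) : R := \sum_(i < s) ((i %/ 2 ^ k == q)%N : nat)%:R.
have La c : \sum_i a c i ^+ 2 <= nb c.1.1 c.2.
  apply: ler_sum => i _; rewrite /a exprMn.
  case: (_ == _); rewrite ?mulr0 ?expr0n ?mulr0//= expr1n mulr1.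
  by rewrite -(real_normK (num_real _)) expr_le1.
have nbub k q : nb k q <= (2 ^ k)%:R.
  by rewrite /nb -natr_sum ler_nat card_block// expn_gt0.
have nb0 k q : 0 <= nb k q by apply: sumr_ge0 => i _; exact: ler0n.
have nbs k : \sum_(q < s) nb k q <= s%:R.
  rewrite exchange_big /= -[X in _ <= X%:R]card_ord -sum1_card natr_sum.
  apply: ler_sum => i _.
  have lt : (i %/ 2 ^ k < s)%N by apply: leq_ltn_trans (ltn_ord i); exact: leq_div.
  rewrite (bigD1 (Ordinal lt)) //= eqxx big1 ?addr0// => q.
  by rewrite -val_eqE /= eq_sym => /negbTE ->.
have budget : \sum_c (\sum_i a c i ^+ 2) ^+ 2 / D c ^+ 4 <= #|'I_s|%:R / 300.
  rewrite card_ord.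
  apply: (@le_trans _ _ (\sum_(c : C) (2 ^ c.1.1)%:R * nb c.1.1 c.2 / D0 c.1.1 ^+ 4)).
    apply: ler_sum => c _; rewrite ler_wpM2r ?invr_ge0 ?exprn_ge0 ?(ltW (D00 _))//.
    rewrite expr2; apply: ler_pM => //; try by apply: sumr_ge0 => i _; exact: sqr_ge0.
    exact: le_trans (La c) (nbub _ _).
  rewrite -(pair_bigA _ (fun (p : 'I_K.+1 * 'I_m) (q : 'I_s) =>
     (2 ^ p.1)%:R * nb p.1 q / D0 p.1 ^+ 4)) /=.
  apply: (@le_trans _ _ (\sum_(p : 'I_K.+1 * 'I_m) (2 ^ p.1)%:R * s%:R / D0 p.1 ^+ 4)).
    apply: ler_sum => p _; rewrite -mulr_suml -mulr_sumr.
    rewrite ler_wpM2r ?invr_ge0 ?exprn_ge0 ?(ltW (D00 _))//.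
    by rewrite ler_wpM2l// ler0n.
  rewrite -(pair_bigA _ (fun (k : 'I_K.+1) (j : 'I_m) => (2 ^ k)%:R * s%:R / D0 k ^+ 4)) /=.
  (* The series of ratio [8 / 10] is at most 5, and [5 / 1500] is the [1 / 300] allowed by
     [partial_coloring]. *)
  apply: (@le_trans _ _ (\sum_(k < K.+1) (s%:R / 1500) * (8 / 10) ^+ (K - k))).
    apply: ler_sum => k _; rewrite sumr_const card_ord -[_ *+ m]mulr_natl.
    have kK : (k <= K)%N by rewrite -ltnS.
    rewrite /D0 exprMn root4K ?(ltW ms0)// -exprM mulnC exprM.
    have sn0 : s%:R != 0 :> R by rewrite pnatr_eq0 -lt0n.
    have mn0 : m%:R != 0 :> R by rewrite pnatr_eq0 -lt0n.
    set x := (K - k)%N.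
    have x9 : 0 < ((9 / 10) ^+ 4) ^+ x :> R by rewrite exprn_gt0// exprn_gt0//; lra.
    have -> : m%:R * ((2 ^ k)%:R * s%:R / (1500 * m%:R * s%:R * ((9 / 10) ^+ 4) ^+ x)) =
        (2 ^ k)%:R / 1500 / ((9 / 10) ^+ 4) ^+ x :> R.
      by field; rewrite sn0 mn0 !andbT expf_neq0 ?expf_neq0//; lra.
    rewrite ler_pdivrMr//.
    (* From [2 ^ k = 2 ^ K * (1 / 2) ^ x] with [2 ^ K <= s], and
       [1 / 2 <= (8 / 10) * (9 / 10) ^ 4]. *)
    have : (2 ^ k)%:R * 1 <= s%:R * ((8 / 10) * (9 / 10) ^+ 4) ^+ x :> R.
      apply: (@le_trans _ _ ((2 ^ K)%:R * (1 / 2) ^+ x)).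
        have eK : (2 ^ K = 2 ^ k * 2 ^ x)%N by rewrite -expnD /x subnKC.
        rewrite mulr1 eK natrM -mulrA [(2 ^ x)%:R]natrX -exprMn.
        by rewrite (_ : 2 * (1 / 2) = 1 :> R) ?expr1n ?mulr1//; field.
      apply: ler_pM; rewrite ?ler0n ?ler_nat//.
      have h94 : 16 / 25 <= (9 / 10) ^+ 4 :> R.
        rewrite (_ : 16 / 25 = (4 / 5) ^+ 2); last by field.
        by rewrite [X in _ <= X](exprM _ 2 2) ler_sqr ?nnegrE ?sqr_ge0//; lra.
      by apply: lerXn2r; rewrite ?nnegrE; lra.
    by rewrite exprMn; lra.
  rewrite -mulr_sumr.
  have := @sum_geometric_le R (8/10) 5 K; move=> /(_ _ _ _)H.
  have {}H : \sum_(k < K.+1) (8 / 10) ^+ (K - k) <= 5 :> R by apply: H; lra.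
  have := ler_wpM2l (ler0n R s) H; lra.
(* Half the difference of [X] and [Y] takes values in -1, 0, 1 and is nonzero exactly where they
   differ; halving turns [2 * D] into [D]. *)
have [|X [Y [far XY]]] := partial_coloring Dgt0 _ budget; first by rewrite card_ord.
exists X, Y; split; first by rewrite card_ord in far.
move=> j t ts.
apply: (@le_trans _ _ (\sum_(k < K.+1) D0 k)); last first.
  rewrite /D0 -mulr_sumr mulrC ler_wpM2r ?(ltW De0)//.
  by apply: sum_geometric_le; lra.
apply: prefix_le_dyadic => [|k q kK]; first exact: leq_ltn_trans sK2.
have [qs|sq] := ltnP q s; last first.
  rewrite big1 ?normr0 ?(ltW (D00 _))// => i /eqP iq.
  by have := leq_div i (2 ^ k); rewrite iq => /(leq_trans sq); rewrite leqNgt ltn_ord.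
have := XY (Ordinal kK, j, Ordinal qs); rewrite /D /= -sumrB.
set S1 := \sum_i _; set S2 := \sum_(i < s | _) _.
have -> : S1 = 2 * S2.
  rewrite /S1 /S2 [in RHS]big_mkcond mulr_sumr; apply: eq_bigr => i _.
  by rewrite /a /=; case: (_ == _) => /=; rewrite ?mulr1 ?mulr0; [field|ring].
by rewrite normrM ger0_norm//; lra.
Qed.

End PrefixColoring.

Lemma sum_take (R : realType) (T : Type) (x0 : T) (r : seq T) (t : nat) (F : T -> R) :
  \sum_(x <- take t r) F x = \sum_(i < size r | (i < t)%N) F (nth x0 r i).
Proof.
rewrite (big_nth x0) size_take_min big_mkord.
rewrite (eq_bigr (fun i : 'I_(minn t (size r)) => F (nth x0 r i))); last first.
  by move=> i _; rewrite nth_take// (leq_trans (ltn_ord i) (geq_minl _ _)).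
rewrite (big_ord_widen _ (fun i => F (nth x0 r i)) (geq_minr t _)).
by apply: eq_bigl => i; rewrite leq_min ltn_ord andbT.
Qed.

(** Allows recursion on the uncolored elements: a prefix of the whole sequence meets them in a
    prefix of their own sequence. *)
Lemma filter_take_prefix (T : Type) (p : pred T) (r : seq T) (t : nat) :
  seq.filter p (take t r) = take (size (seq.filter p (take t r))) (seq.filter p r).
Proof. by rewrite -{3}(cat_take_drop t r) filter_cat take_size_cat. Qed.

(* Each round leaves at most [9 / 10] of the elements uncolored, and
   [(9 / 10) ^ (1 / 4) <= 39 / 40], so the round costs [10 * Delta] form a geometric
   series of sum at most [400 * Delta]. *)
Lemma prefix_discrepancy (R : realType) (T : eqType) (m : nat)
    (g : 'I_m -> T -> R) (r : seq T) :
  (forall j x, `|g j x| <= 1) -> uniq r ->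
  exists chi : T -> bool, forall j t,
    `|\sum_(x <- take t r) g j x * spin (chi x)| <=
    400 * root4 (1500 * m%:R * (size r)%:R).
Proof.
move=> g1; have [n] := ubnP (size r); elim: n r => // n IH r rn ur.
case: (posnP (size r)) => [/size0nil ->|s0].
  exists xpredT => j t; rewrite take_oversize// big_nil normr0.
  by apply: mulr_ge0; [exact: ler0n|exact: root4_ge0].
have x0 : T by case: (r) s0.
set s := size r in s0 rn *.
have [X [Y [far XY]]] :=
  @partial_prefix_coloring R s m (fun j i => g j (nth x0 r i)) (fun j i => g1 j _) s0.
pose fX (Z : {ffun 'I_s -> bool}) x :=
  if insub (index x r) is Some i then Z i else false.
have fXE Z (i : 'I_s) : fX Z (nth x0 r i) = Z i.
  by rewrite /fX index_uniq// ?valK.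
pose col x := fX X x != fX Y x.
pose r' := [seq x <- r | ~~ col x].
have sumXY : (size r' + #|[set i | X i != Y i]%SET| = s)%N.
  rewrite -[RHS](count_predC (predC col) r) /r' size_filter; congr addn.
  rewrite -[r in RHS](mkseq_nth x0) /mkseq count_map -/s.
  rewrite -val_enum_ord count_map cardE size_filter.
  by rewrite enumT; apply: eq_count => i /=; rewrite inE negbK /col !fXE.
have r's : (10 * size r' <= 9 * s)%N by lia.
have [||chi' Hchi'] := IH r'; first by lia.
  exact: filter_uniq.
exists (fun x => if col x then fX X x else chi' x) => j t.
rewrite (bigID col) /=; apply: (le_trans (ler_normD _ _)).
set De := root4 (1500 * m%:R * s%:R).
(* The colored elements cost [10 * De], and the recursive call [400 * (39 / 40) * De]. *)
have -> : 400 * De = 10 * De + 390 * De by ring.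
apply: lerD.
  have := XY j (minn t s) (geq_minr _ _).
  congr (`| _ | <= _).
  rewrite [RHS]big_mkcond (sum_take x0) -/s.
  apply: eq_big => [i|i _]; first by rewrite leq_min ltn_ord andbT.
  by rewrite /col !fXE; case: (X i); case: (Y i) => /=; rewrite /spin; field.
rewrite -big_filter filter_take_prefix -/r'.
rewrite (eq_big_seq (fun x => g j x * spin (chi' x))); last first.
  by move=> x /mem_take; rewrite mem_filter => /andP[/negbTE ->].
apply: (le_trans (Hchi' j _)).
have : root4 (1500 * m%:R * (size r')%:R) <= 39 / 40 * De.
  apply: root4_le; [lra|by rewrite !mulr_ge0 ?ler0n|].
  have h94 : 9 / 10 <= (39 / 40) ^+ 4 :> R.
    have h : 19 / 20 <= (39 / 40) ^+ 2 :> R by nra.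
    rewrite [X in _ <= X](exprM _ 2 2).
    apply: (@le_trans _ _ ((19 / 20) ^+ 2)); first by nra.
    by rewrite ler_sqr ?nnegrE ?sqr_ge0//; lra.
  have h1 : (size r')%:R <= 9 / 10 * s%:R :> R.
    by move: r's; rewrite -(ler_nat R) !natrM; lra.
  have h2 : (size r')%:R <= (39 / 40) ^+ 4 * s%:R :> R.
    by apply: le_trans h1 _; rewrite ler_wpM2r// ler0n.
  have := ler_wpM2l (mulr_ge0 (ler0n R 1500) (ler0n R m)) h2.
  by set z := (39 / 40) ^+ 4; lra.
lra.
Qed.

(** * Clusters from flipping paths *)

Lemma hammingC n (X Y : cube n) : hamming X Y = hamming Y X.
Proof. by apply: eq_card => i; rewrite !inE eq_sym. Qed.

Lemma hamming_eq0 n (X Y : cube n) : hamming X Y = 0%N -> X = Y.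
Proof.
move=> /eqP; rewrite cards_eq0 => /eqP/setP h; apply/ffunP => i.
by have := h i; rewrite !inE => /negbFE/eqP.
Qed.

Lemma hamming_le_diameter n (C : {set cube n}) X Y :
  X \in C -> Y \in C -> (hamming X Y <= diameter C)%N.
Proof.
move=> XC YC; rewrite /diameter (bigmaxD1 X)//=.
apply: leq_trans (leq_maxl _ _); exact: (leq_bigmax_cond (F := hamming X)).
Qed.

Lemma diameter_le n (C : {set cube n}) : (diameter C <= n)%N.
Proof.
apply/bigmax_leqP => X _; apply/bigmax_leqP => Y _.
by rewrite -[X in (_ <= X)%N]card_ord max_card.
Qed.

(** The points of the path form a connected subset of [S], which extends to a maximal one containing
    both ends. *)
Lemma cluster_of_path n (S : {set cube n}) (p : nat -> cube n) (T : nat) :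
  (forall t, (t <= T)%N -> p t \in S) ->
  (forall t, (t < T)%N -> (hamming (p t) (p t.+1) <= 1)%N) ->
  exists2 C, is_cluster S C & (hamming (p 0%N) (p T) <= diameter C)%N.
Proof.
move=> pS pstep; pose A := [set p (t : 'I_T.+1) | t in 'I_T.+1]%SET.
have pA t : (t <= T)%N -> p t \in A.
  by move=> tT; apply/imsetP; exists (Ordinal (tT : (t < T.+1)%N)).
have con t : (t <= T)%N -> connect (adjacent_in A) (p 0%N) (p t).
  elim: t => [|t IH] tT; first exact: connect0.
  apply: connect_trans (IH (ltnW tT)) _.
  have := pstep t tT; case E : (hamming _ _) => [|[|]]// _.
    by rewrite (hamming_eq0 E) connect0.
  by apply: connect1; rewrite /adjacent_in !pA ?(ltnW tT)// E.
have csym : connect_sym (adjacent_in A).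
  by apply: sym_connect_sym => X Y; rewrite /adjacent_in hammingC andbCA.
have PA : (A \subset S) && connected_set A.
  apply/andP; split.
    by apply/fintype.subsetP => _ /imsetP[t _ ->]; apply: pS; rewrite -ltnS.
  apply/andP; split; first by apply/set0Pn; exists (p 0%N); exact: pA.
  apply/forall_inP => _ /imsetP[t _ ->]; apply/forall_inP => _ /imsetP[u _ ->].
  apply: (@connect_trans _ _ (p 0%N)); last by rewrite con// -ltnS.
  by rewrite csym con// -ltnS.
have [C mC /fintype.subsetP AC] :=
  @maxset_exists _ (fun B : {set cube n} => (B \subset S) && connected_set B) A PA.
by exists C => //; apply: hamming_le_diameter; apply: AC; apply: pA.
Qed.

Definition flip_seq n (X : cube n) (r : seq 'I_n) (t : nat) : cube n :=
  [ffun i => (i \in take t r) (+) X i].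

Lemma cluster_of_flips n (S : {set cube n}) (X : cube n) (r : seq 'I_n) :
  uniq r -> (forall t, flip_seq X r t \in S) ->
  exists2 C, is_cluster S C & (size r <= diameter C)%N.
Proof.
move=> ur XS.
have [] := @cluster_of_path n S (flip_seq X r) (size r).
- by [].
- move=> t tr; case: (r) tr => // x0 r' tr; rewrite -(cards1 (nth x0 (x0 :: r') t)).
  apply/subset_leq_card/fintype.subsetP => i.
  rewrite !inE !ffunE (take_nth x0 tr) mem_rcons in_cons.
  by case: (i == _) => //=; rewrite eqxx.
move=> C CS h; exists C => //; apply: leq_trans h.
rewrite -[X in (X <= _)%N](card_uniqP ur); apply/subset_leq_card/fintype.subsetP => i ir.
by rewrite !inE !ffunE take0 take_size ir; case: (X i).
Qed.

Lemma sum_flip_seq (R : realType) n (X : cube n) (r : seq 'I_n) t (g : 'I_n -> R) :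
  uniq r ->
  \sum_i g i * spin (flip_seq X r t i) =
  \sum_i g i * spin (X i) - 2 * \sum_(i <- take t r) g i * spin (X i).
Proof.
move=> ur; rewrite (big_uniq _ (take_uniq t ur)) /= [X in 2 * X]big_mkcond /=.
rewrite mulr_sumr -sumrB; apply: eq_bigr => i _; rewrite ffunE.
by case: (i \in _); case: (X i); rewrite /spin /=; ring.
Qed.

(** * The symmetric perceptron *)

Lemma discrepancy_le (R : realType) (alpha c : R) (m n s : nat) :
  0 <= c -> 1500 * alpha <= (c / 400) ^+ 4 -> m%:R <= alpha * n%:R -> (s <= n)%N ->
  400 * root4 (1500 * m%:R * s%:R) <= c * Num.sqrt n%:R.
Proof.
move=> c0 ac mn sn.
have -> : c * Num.sqrt n%:R = 400 * (c / 400 * root4 (n%:R ^+ 2)).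
  by rewrite /root4 sqrtr_sqr ger0_norm ?ler0n//; field.
apply: ler_wpM2l; first exact: ler0n.
apply: root4_le; [|exact: sqr_ge0|].
  by apply: (divr_ge0 c0); exact: ler0n.
apply: (@le_trans _ _ (1500 * alpha * n%:R ^+ 2)); last first.
  by rewrite ler_wpM2r// sqr_ge0.
have -> : 1500 * alpha * n%:R ^+ 2 = 1500 * (alpha * n%:R) * n%:R by ring.
have h15 : 0 <= 1500 :> R by lra.
apply: ler_pM; [exact: mulr_ge0|exact: ler0n|exact: ler_wpM2l|].
by rewrite ler_nat.
Qed.

Lemma spin_norm (R : realType) b : `|spin b : R| = 1.
Proof. by case: b; rewrite /spin ?normrN normr1. Qed.

Lemma nb_constraints_le (R : realType) (alpha : R) n : 0 <= alpha ->
  (nb_constraints alpha n)%:R <= alpha * n%:R.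
Proof. by move=> a0; rewrite truncn_le mulr_ge0 ?ler0n. Qed.

(** After flipping a prefix, a row sum is the full sum minus twice the prefix sum, that is at most
    three times the prefix bound; hence [kappa / 3]. *)
Lemma sbp_cluster (R : realType) (kappa alpha : R) (m n : nat) (G : 'M[bool]_(m, n)) :
  0 < kappa -> 1500 * alpha <= (kappa / 3 / 400) ^+ 4 -> m%:R <= alpha * n%:R ->
  exists2 C, is_cluster (sbp_solutions kappa G) C & diameter C = n.
Proof.
move=> k0 ak mn; pose r := enum 'I_n.
have ur : uniq r by exact: enum_uniq.
have sr : size r = n by rewrite size_enum_ord.
have [|chi Hchi] := @prefix_discrepancy R _ m (fun j i => spin (G j i)) r _ ur.
  by move=> j i; rewrite spin_norm.
pose X : cube n := finfun chi.
have F : 400 * root4 (1500 * m%:R * (size r)%:R) <= kappa / 3 * Num.sqrt n%:R.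
  by apply: discrepancy_le mn _; rewrite ?sr ?divr_ge0// ltW.
have Hsum j t : `|\sum_(i <- take t r) spin (G j i) * spin (X i)| <=
    kappa / 3 * Num.sqrt n%:R.
  apply: le_trans F; apply: le_trans (Hchi j t).
  by rewrite le_eqVlt; apply/orP; left; apply/eqP; congr `| _ |; apply: eq_bigr => i _; rewrite ffunE.
have [|C CS h] := @cluster_of_flips n (sbp_solutions kappa G) X r ur.
  move=> t; rewrite inE; apply/forallP => j.
  rewrite /margin normrM ger0_norm ?invr_ge0 ?sqrtr_ge0//.
  (* For [n = 0] the factor [(sqrt n)^-1] is 0, and so is every margin. *)
  case: (posnP n) => [n0|n0].
    by rewrite {1}n0 sqrtr0 invr0 mul0r ltW.
  have sn : 0 < Num.sqrt n%:R :> R by rewrite sqrtr_gt0 ltr0n.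
  rewrite mulrC ler_pdivrMr// sum_flip_seq//.
  have := Hsum j t; have := Hsum j n; rewrite take_oversize ?sr// big_enum /=.
  rewrite !ler_norml => /andP[? ?] /andP[? ?]; apply/andP; split; lra.
exists C => //; apply/eqP; rewrite eqn_leq diameter_le /=.
by move: h; rewrite sr.
Qed.

Lemma Prob_mean (R : realType) m n (E : pred 'M[bool]_(m, n)) :
  Prob R E = mean (fun G => (E G : nat)%:R).
Proof.
rewrite /Prob /mean mulr_sumr big_mkcond /=; apply: eq_bigr => G _.
case: (E G); rewrite ?mulr0// mulr1 /uniform_spin.
by rewrite !prodr_const !card_ord card_bool -exprM exprVn card_mx card_bool natrX mulnC.
Qed.

(** * Fractional solutions and their rounding *)

Definition norm2 {R : realType} {m : nat} (y : 'I_m -> R) : R :=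
  Num.sqrt (\sum_j y j ^+ 2).

Section Norm2.
Variables (R : realType) (m : nat).
Implicit Types y : 'I_m -> R.

Lemma norm2_ge0 y : 0 <= norm2 y. Proof. exact: sqrtr_ge0. Qed.

Lemma sqr_norm2 y : norm2 y ^+ 2 = \sum_j y j ^+ 2.
Proof. by rewrite sqr_sqrtr// sumr_ge0// => *; exact: sqr_ge0. Qed.

Lemma le_norm2 y j : y j <= norm2 y.
Proof.
apply: (le_trans (ler_norm _)); rewrite -ler_sqr ?nnegrE ?norm2_ge0//.
rewrite real_normK ?num_real// sqr_norm2 (bigD1 j)//= lerDl.
by apply: sumr_ge0 => *; exact: sqr_ge0.
Qed.

(** Cauchy-Schwarz, from the nonnegative sum of the squares [(m * y j - S) ^ 2], where [S] is the
    sum of [y]. *)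
Lemma sum_le_norm2 y : \sum_j y j <= Num.sqrt m%:R * norm2 y.
Proof.
have [m0|m0] := posnP m.
  rewrite big1 ?mulr_ge0 ?sqrtr_ge0// => j _; have := ltn_ord j.
  by rewrite [X in (_ < X)%N]m0.
have mp : 0 < m%:R :> R by rewrite ltr0n.
apply: (le_trans (ler_norm _)); rewrite -ler_sqr ?nnegrE ?mulr_ge0 ?sqrtr_ge0//.
rewrite real_normK ?num_real// exprMn sqr_norm2 sqr_sqrtr ?(ltW mp)//.
set S := \sum_j y j; set Q := \sum_j _.
have : 0 <= \sum_j (m%:R * y j - S) ^+ 2 by apply: sumr_ge0 => *; exact: sqr_ge0.
rewrite (eq_bigr (fun j => m%:R ^+ 2 * y j ^+ 2 + ((- 2 * m%:R * S) * y j + S ^+ 2))); last first.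
  by move=> j _; ring.
rewrite !big_split /= -!mulr_sumr sumr_const card_ord -/S -/Q -[_ *+ m]mulr_natl.
by move=> h; rewrite -subr_ge0 -(pmulr_rge0 _ mp); lra.
Qed.

End Norm2.

Section FractionalSolution.
Variables (R : realType) (m n : nat) (G : 'M[bool]_(m, n)) (a : nat).

Let g j i : R := spin (G j i).

(* Net argument: [y] is rounded down to a multiple of [|y| / (H sqrt m)] in each
   coordinate, and the rounding error is controlled by the bilinear form bound. *)
Lemma dual_norm_lower_bound (H : R) :
  4 <= H -> 100 * n%:R <= H * a%:R -> (0 < m)%N ->
  (forall z : 'I_m -> nat, (0 < \sum_j z j)%N -> (\sum_j z j)%:R <= H * m%:R ->
    a%:R / 5 * norm2 (fun j => (z j)%:R) <=
    \sum_(i < n | (i < a)%N) `|\sum_j g j i * (z j)%:R|) ->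
  (forall x : cube n,
    \sum_j `|\sum_i g j i * spin (x i)| <= 5 * n%:R * Num.sqrt m%:R) ->
  forall y : 'I_m -> R, (forall j, 0 <= y j) ->
    a%:R / 20 * norm2 y <= \sum_(i < n | (i < a)%N) `|\sum_j g j i * y j|.
Proof.
move=> H4 Ha m0 Hz Hx y y0.
have [->|Yn0] := eqVneq (norm2 y) 0.
  by rewrite mulr0 sumr_ge0.
have Y0 : 0 < norm2 y by rewrite lt0r Yn0 norm2_ge0.
set Y := norm2 y in Yn0 Y0 *.
have sm : 0 < Num.sqrt m%:R :> R by rewrite sqrtr_gt0 ltr0n.
have sm2 : Num.sqrt m%:R ^+ 2 = m%:R :> R by rewrite sqr_sqrtr.
set q := Num.sqrt m%:R in sm sm2 Hx *.
(* With this scale [c * y] has norm [H * sqrt m] and its coordinates sum to at most [H * m], so its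
   integer part [z] falls under the hypothesis on integer vectors. *)
pose c := H * q / Y.
have H0 : 0 < H by lra.
have c0 : 0 < c by rewrite divr_gt0// mulr_gt0.
have cy0 j : 0 <= c * y j by rewrite mulr_ge0// ltW.
pose z j := Num.truncn (c * y j).
have zle j : (z j)%:R <= c * y j by rewrite truncn_le.
have zge j : c * y j - 1 <= (z j)%:R.
  by have := truncnS_gt (c * y j); rewrite -natr1 -/(z j); lra.
pose f j := c * y j - (z j)%:R.
have sy : \sum_j y j <= q * Y by exact: sum_le_norm2.
have csy : c * \sum_j y j <= H * m%:R.
  apply: (le_trans (ler_wpM2l (ltW c0) sy)).
  by rewrite -sm2 le_eqVlt; apply/orP; left; apply/eqP; rewrite /c; field.
have szle : (\sum_j z j)%:R <= H * m%:R.
  by rewrite natr_sum; apply: le_trans csy; rewrite mulr_sumr ler_sum.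
(* Rounding keeps half of the norm: [floor(u) ^ 2 >= u ^ 2 - 2 * u] for [u >= 0], and
   [H ^ 2 - 2 * H >= H ^ 2 / 4] as [H >= 4]. *)
have nz : (q * H / 2) ^+ 2 <= \sum_j (z j)%:R ^+ 2.
  apply: (@le_trans _ _ (\sum_j (c ^+ 2 * y j ^+ 2 - 2 * (c * y j)))).
    rewrite sumrB -!mulr_sumr -sqr_norm2 -/Y.
    have -> : c ^+ 2 * Y ^+ 2 = H ^+ 2 * m%:R by rewrite -sm2 /c; field.
    have := csy.
    rewrite !exprMn sm2 exprVn.
    have m1 : 0 <= m%:R :> R by [].
    have : 0 <= m%:R * (H * (3 * H - 8)) by rewrite mulr_ge0// mulr_ge0//; lra.
    have -> : (2 ^+ 2)^-1 = 1 / 4 :> R by field.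
    lra.
  apply: ler_sum => j _; rewrite -exprMn.
  have := zle j; have := zge j; have := cy0 j; have : 0 <= (z j)%:R :> R by [].
  move: (c * y j) ((z j)%:R) => u v; nra.
have nz' : q * H / 2 <= norm2 (fun j => (z j)%:R).
  rewrite -ler_sqr ?nnegrE ?norm2_ge0 ?sqr_norm2//.
  by rewrite divr_ge0// mulr_ge0// ltW.
have zpos : (0 < \sum_j z j)%N.
  rewrite lt0n; apply: contraTN nz => /eqP/eqP; rewrite sum_nat_eq0 => /forallP z0.
  rewrite [X in _ <= X]big1; last by move=> j _; rewrite (eqP (z0 j)) expr0n.
  by rewrite -ltNge exprn_gt0// divr_gt0// mulr_gt0.
have low := Hz z zpos szle.
(* The remainders [f j] lie between 0 and 1; taking the signs of the column sums as [x] leaves the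
   bilinear form. *)
have up : \sum_(i < n | (i < a)%N) `|\sum_j g j i * f j| <= 5 * n%:R * q.
  pose x : cube n := [ffun i => 0 <= \sum_j g j i * f j].
  apply: le_trans (Hx x).
  apply: (@le_trans _ _ (\sum_i spin (x i) * \sum_j g j i * f j)).
    rewrite big_mkcond /=; apply: ler_sum => i _; rewrite ffunE.
    set S := \sum_j _.
    have -> : spin (0 <= S) * S = `|S|.
      case: (lerP 0 S) => S0; rewrite /spin /=.
        by rewrite mul1r ger0_norm.
      by rewrite mulN1r ltr0_norm.
    by case: (_ < _)%N.
  rewrite (eq_bigr (fun i => \sum_j f j * (g j i * spin (x i)))); last first.
    by move=> i _; rewrite mulr_sumr; apply: eq_bigr => j _; ring.
  rewrite exchange_big /=; apply: ler_sum => j _; rewrite -mulr_sumr.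
  apply: (le_trans (ler_norm _)); rewrite normrM ler_piMl//.
  by rewrite ger0_norm /f; have := zle j; have := truncnS_gt (c * y j);
    rewrite -natr1 -/(z j); lra.
have tri : \sum_(i < n | (i < a)%N) `|\sum_j g j i * (z j)%:R| <=
   c * \sum_(i < n | (i < a)%N) `|\sum_j g j i * y j| +
   \sum_(i < n | (i < a)%N) `|\sum_j g j i * f j|.
  rewrite mulr_sumr -big_split /=; apply: ler_sum => i _.
  rewrite -[c in c * _](gtr0_norm c0) -normrM.
  have -> : \sum_j g j i * (z j)%:R = c * (\sum_j g j i * y j) - \sum_j g j i * f j.
    by rewrite mulr_sumr -sumrB; apply: eq_bigr => j _; rewrite /f; ring.
  exact: ler_normB.
set S := \sum_(i < n | _) `|\sum_j g j i * y j| in tri *.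
have a0 : 0 <= a%:R / 5 :> R by rewrite divr_ge0.
have := ler_wpM2l a0 nz' => low2.
(* As [100 * n <= H * a], the error [5 * n * q] is at most half of the main term. *)
have key : a%:R / 5 * (q * H / 2) - 5 * n%:R * q <= c * S by lra.
have cY : c * Y = H * q by rewrite /c; field.
rewrite -(ler_pM2l c0); apply: le_trans key.
rewrite mulrCA cY.
have := ler_wpM2l (ltW sm) Ha; lra.
Qed.

End FractionalSolution.

Lemma exists_minimum (R : realType) (T : finType) (F : T -> R) (x0 : T) :
  exists x, forall y, F x <= F y.
Proof. by case: (@arg_minP _ _ T x0 xpredT F isT) => x _ h; exists x => y; exact: h. Qed.

(** Second-order upper bound for the square of the positive part, a function with 2-Lipschitz
    derivative. *)
Lemma sqr_pos_part_le (R : realType) (t s d : R) :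
  Num.max 0 (t - (s + d)) ^+ 2 <=
  Num.max 0 (t - s) ^+ 2 - 2 * d * Num.max 0 (t - s) + d ^+ 2.
Proof.
case: (lerP 0 (t - s)) => h1; case: (lerP 0 (t - (s + d))) => h2; try nra.
Qed.

Section Minimisation.
Variables (R : realType) (m n : nat) (g : 'I_m -> 'I_n -> R) (P : pred 'I_n).
Hypothesis g1 : forall j i, g j i ^+ 2 = 1.

Let x (k : nat) (c : 'I_n -> nat) i : R := 1 - 2 * (c i)%:R / 2 ^+ k.

(* Duality without compactness: a minimizer [x] of
   [\sum_j max(0, t - (g x)_j)^2] over a fine dyadic grid of the cube satisfies
   the optimality conditions up to the mesh, so the residual [y] has
   [|g^T y|_1 <= <y, g x> + small <= t * sqrt m * |y| + small], contradicting the
   dual bound unless [y] is small. *)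
Lemma fractional_solution (b t : R) :
  0 < b -> 0 <= t -> t * Num.sqrt m%:R <= b * #|P|%:R -> (0 < #|P|)%N ->
  (forall y : 'I_m -> R, (forall j, 0 <= y j) ->
    2 * b * #|P|%:R * norm2 y <= \sum_(i | P i) `|\sum_j g j i * y j|) ->
  exists k (c : 'I_n -> nat), (forall i, (c i <= 2 ^ k)%N) /\
    forall j, t - 1 <= \sum_(i | P i) g j i * (1 - 2 * (c i)%:R / 2 ^+ k).
Proof.
move=> b0 t0 tb P0 dual.
set p := #|P|%:R in tb dual *.
have p0 : 0 < p :> R by rewrite ltr0n.
(* As [k < 2 ^ k], the mesh [h] satisfies [h * m <= b]. *)
pose k := Num.truncn (2 * m%:R / b).
pose h : R := 2 / 2 ^+ k.
have k2 : 0 < 2 ^+ k :> R by rewrite exprn_gt0.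
have h0 : 0 < h by rewrite divr_gt0.
have hm : h * m%:R <= b.
  rewrite /h mulrAC ler_pdivrMr// -ler_pdivrMl//.
  rewrite mulrC; apply: (@le_trans _ _ (k.+1)%:R); first exact/ltW/truncnS_gt.
  by rewrite -natrX ler_nat ltn_expl.
pose s (c : {ffun 'I_n -> 'I_(2 ^ k).+1}) j :=
  \sum_(i | P i) g j i * x k (fun i => c i) i.
pose y c j : R := Num.max 0 (t - s c j).
have [c minc] := exists_minimum (fun c => \sum_j y c j ^+ 2)
  ([ffun=> ord0] : {ffun 'I_n -> 'I_(2 ^ k).+1}).
have y0 j : 0 <= y c j by rewrite le_max lexx.
have move_c i (u : 'I_(2 ^ k).+1) d : P i ->
    x k (fun _ => u) i = x k (fun i => c i) i + d ->
    2 * d * (\sum_j g j i * y c j) <= d ^+ 2 * m%:R.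
  move=> Pi ud.
  pose c' : {ffun 'I_n -> 'I_(2 ^ k).+1} := [ffun l => if l == i then u else c l].
  have sc j : s c' j = s c j + g j i * d.
    rewrite /s (bigD1 i)//= [in RHS](bigD1 i)//= /x ffunE eqxx.
    have := ud; rewrite /x => ->.
    rewrite (eq_bigr (fun l => g j l * (1 - 2 * (c l)%:R / 2 ^+ k))); last first.
      by move=> l /andP[_ /negbTE li]; rewrite ffunE li.
    by ring.
  have : \sum_j y c' j ^+ 2 <=
      \sum_j (y c j ^+ 2 - 2 * (g j i * d) * y c j + (g j i * d) ^+ 2).
    by apply: ler_sum => j _; rewrite /y sc; exact: sqr_pos_part_le.
  move=> /(le_trans (minc c')).
  rewrite [X in _ <= X](eq_bigr (fun j => y c j ^+ 2 + ((- (2 * d)) * (g j i * y c j) + d ^+ 2))); last first.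
    by move=> j _; rewrite exprMn g1; ring.
  rewrite !big_split /= -mulr_sumr sumr_const card_ord -[_ *+ m]mulr_natr.
  by lra.
(* First-order conditions: minimality bounds [q] above by [h * m / 2] if [x i] can increase, and
   below by the opposite if it can decrease. So [q] is small in the interior, and at an end point
   has the sign of [x i] up to this error. *)
have coord i : P i ->
    `|\sum_j g j i * y c j| <= x k (fun i => c i) i * (\sum_j g j i * y c j) + h * m%:R.
  move=> Pi; set q := \sum_j _.
  have c2k : (c i <= 2 ^ k)%N by rewrite -ltnS.
  have xlo : -1 <= x k (fun i => c i) i.
    have : (c i)%:R <= 2 ^+ k :> R by rewrite -natrX ler_nat.
    rewrite /x -(ler_pM2r (x := (2 ^+ k)^-1)) ?invr_gt0// mulfV ?gt_eqF//; lra.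
  have xhi : x k (fun i => c i) i <= 1.
    by rewrite /x gerBl divr_ge0// ?mulr_ge0// ltW.
  have up : (0 < c i)%N -> q <= h * m%:R / 2.
    move=> ci; have lt : ((c i).-1 < (2 ^ k).+1)%N by rewrite ltnS (leq_trans (leq_pred _) c2k).
    have := @move_c i (Ordinal lt) h Pi; rewrite -/q => /(_ _)H.
    have {}H : 2 * h * q <= h ^+ 2 * m%:R.
      apply: H; rewrite /x /h /= -[in RHS](prednK ci) -[((c i).-1.+1)%:R]natr1.
      by field; rewrite gt_eqF.
    by rewrite -(ler_pM2l h0); lra.
  have dn : (c i < 2 ^ k)%N -> - (h * m%:R / 2) <= q.
    move=> ci; have lt : ((c i).+1 < (2 ^ k).+1)%N by rewrite ltnS.
    have := @move_c i (Ordinal lt) (- h) Pi; rewrite -/q => /(_ _)H.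
    have {}H : 2 * (- h) * q <= (- h) ^+ 2 * m%:R.
      apply: H; rewrite /x /h /= -natr1.
      by field; rewrite gt_eqF.
    by rewrite -(ler_pM2l h0); move: H; rewrite sqrrN; lra.
  have hm0 : 0 <= h * m%:R by rewrite mulr_ge0// ltW.
  case: (posnP (c i)) => [c0|/up {}up].
    have xE : x k (fun i => c i) i = 1 by rewrite /x c0 mulr0 mul0r subr0.
    have {}dn : - (h * m%:R / 2) <= q by apply: dn; rewrite c0 expn_gt0.
    by rewrite xE mul1r ler_norml; apply/andP; split; lra.
  case: (ltnP (c i) (2 ^ k)) => [/dn {}dn|ck].
    rewrite ler_norml; apply/andP; split; nra.
  have xE : x k (fun i => c i) i = -1.
    have cE : nat_of_ord (c i) = (2 ^ k)%N by apply/eqP; rewrite eqn_leq c2k ck.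
    by rewrite /x cE natrX mulfK ?gt_eqF//; lra.
  by rewrite xE ler_norml; apply/andP; split; lra.
have ys : \sum_j y c j * s c j <= t * \sum_j y c j.
  rewrite mulr_sumr; apply: ler_sum => j _; rewrite mulrC /y.
  by case: (lerP 0 (t - s c j)) => ?; rewrite ?mulr0// ler_wpM2r//; lra.
have tot : \sum_(i | P i) `|\sum_j g j i * y c j| <= t * \sum_j y c j + p * (h * m%:R).
  apply: (le_trans (ler_sum _ coord)); rewrite big_split /= sumr_const.
  rewrite -[_ *+ _]mulr_natl; apply: lerD => //.
  apply: le_trans ys; rewrite le_eqVlt; apply/orP; left; apply/eqP.
  rewrite (eq_bigr (fun i => \sum_j y c j * (g j i * x k (fun i => c i) i))).
    by rewrite exchange_big /=; apply: eq_bigr => j _; rewrite -mulr_sumr.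
  by move=> i _; rewrite mulr_sumr; apply: eq_bigr => j _; ring.
(* Dual bound, [tot] and Cauchy-Schwarz give [2 * b * p * |y| <= b * p * |y| + p * b]. *)
have yn : norm2 (y c) <= 1.
  have h1 := le_trans (dual _ y0) tot.
  have h2 := ler_wpM2l t0 (sum_le_norm2 (y c)).
  have h3 := ler_wpM2r (norm2_ge0 (y c)) tb.
  have h4 := ler_wpM2l (ltW p0) hm.
  have bp : 0 < b * p by rewrite mulr_gt0.
  by rewrite -(ler_pM2l bp); lra.
exists k, (fun i => nat_of_ord (c i)); split=> [i|j]; first by rewrite -ltnS.
have := le_trans (le_norm2 (y c) j) yn.
rewrite {1}/y ge_max => /andP[_]; rewrite /s /x; lra.
Qed.

End Minimisation.

(** The lowest binary digit is removed by moving the odd [c i] up or down by one as a coloring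
    prescribes. From denominator [2 ^ k.+1] this costs [D / 2 ^ k], and these costs form a geometric
    series. *)
Lemma bit_rounding (R : realType) (m n : nat) (g : 'I_m -> 'I_n -> R)
    (P : pred 'I_n) (D : R) (k : nat) (c : 'I_n -> nat) :
  (forall S : {set 'I_n}, exists chi : 'I_n -> bool, forall j,
     `|\sum_(i in S) g j i * spin (chi i)| <= D) ->
  (forall i, (c i <= 2 ^ k)%N) ->
  exists d : 'I_n -> bool, forall j,
    `|\sum_(i | P i) g j i * (1 - 2 * (c i)%:R / 2 ^+ k) -
      \sum_(i | P i) g j i * spin (d i)| <= 2 * D * (1 - (2 ^+ k)^-1).
Proof.
move=> disc; elim: k c => [|k IH] c ck.
  exists (fun i => c i == 0%N) => j.
  rewrite expr0 invr1 subrr mulr0 -sumrB big1 ?normr0// => i _.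
  by have := ck i; rewrite expn0; case: (c i) => [|[|]]//= _; rewrite /spin; field.
pose S := [set i | P i && odd (c i)]%SET.
have [chi Hchi] := disc S.
pose c' i := ((c i + (odd (c i) && chi i))./2)%N.
have c'k i : (c' i <= 2 ^ k)%N.
  rewrite /c'; have := ck i; rewrite expnS; move: (2 ^ k)%N => N h.
  by case: (odd (c i)) (odd_double_half (c i)) => /=; case: (chi i); lia.
have [d Hd] := IH c' c'k; exists d => j.
have c'E i : (c' i)%:R * 2 = (c i)%:R + (odd (c i) : nat)%:R * spin (chi i) :> R.
  have e : (c' i * 2 + (odd (c i) && ~~ chi i) = c i + (odd (c i) && chi i))%N.
    by rewrite /c'; case: (odd (c i)) (odd_double_half (c i)) => /=; case: (chi i) => /=; lia.
  have := congr1 (fun u : nat => u%:R : R) e; rewrite !natrD natrM.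
  by case: (odd (c i)); case: (chi i); rewrite /spin /=; lra.
have k2 : 0 < 2 ^+ k :> R by rewrite exprn_gt0.
set s1 := \sum_(i | P i) _; set s2 := \sum_(i | P i) _.
have := Hd j; set s3 := \sum_(i | P i) _; rewrite -/s2 => h.
have s13 : s1 - s3 = (\sum_(i in S) g j i * spin (chi i)) / 2 ^+ k.
  rewrite /s1 /s3 -sumrB mulr_suml [RHS]big_mkcond [LHS]big_mkcond /=.
  apply: eq_bigr => i _; rewrite inE; case: (P i) => //=.
  have -> : (c i)%:R = (c' i)%:R * 2 - (odd (c i) : nat)%:R * spin (chi i) :> R.
    by rewrite c'E addrK.
  rewrite exprS; case: (odd (c i)) => /=; field; exact: lt0r_neq0.
have h13 : `|s1 - s3| <= D / 2 ^+ k.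
  rewrite s13 normrM (ger0_norm (x := (2 ^+ k)^-1)) ?invr_ge0 ?(ltW k2)//.
  by rewrite ler_wpM2r ?invr_ge0 ?(ltW k2).
have -> : s1 - s2 = (s1 - s3) + (s3 - s2) by ring.
apply: (le_trans (ler_normD _ _)); apply: (le_trans (lerD h13 h)).
rewrite le_eqVlt; apply/orP; left; apply/eqP.
by rewrite exprS; field; exact: lt0r_neq0.
Qed.

(** * Deterministic construction for the asymmetric perceptron *)

Section AbpCluster.
Variables (R : realType) (kappa alpha H : R) (m n a : nat) (G : 'M[bool]_(m, n)).
Let g j i : R := spin (G j i).

(** Budget in each row, with [q = sqrt n]: the first [a] columns give at least
    [(|kappa| + 2) * q - 1] fractionally and lose [2 * q / 5] in the rounding; the others, during
    the flips, take away at most [3 * q / 5]. What remains is at least [kappa * q] because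
    [q >= 1]. *)
Lemma abp_cluster :
  (0 < n)%N -> (0 < m)%N -> (0 < a)%N -> (a <= n)%N ->
  m%:R <= alpha * n%:R -> 1500 * alpha <= (1 / 5 / 400) ^+ 4 ->
  4 <= H -> 100 * n%:R <= H * a%:R ->
  (`|kappa| + 2) * Num.sqrt n%:R * Num.sqrt m%:R <= 1 / 40 * a%:R ->
  (forall z : 'I_m -> nat, (0 < \sum_j z j)%N -> (\sum_j z j)%:R <= H * m%:R ->
    a%:R / 5 * norm2 (fun j => (z j)%:R) <=
    \sum_(i < n | (i < a)%N) `|\sum_j g j i * (z j)%:R|) ->
  (forall x : cube n,
    \sum_j `|\sum_i g j i * spin (x i)| <= 5 * n%:R * Num.sqrt m%:R) ->
  exists2 C, is_cluster (abp_solutions kappa G) C & (n - a <= diameter C)%N.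
Proof.
move=> n0 m0 a0 an mn al H4 Ha ta Hz Hx.
have sn1 : 1 <= Num.sqrt n%:R :> R.
  by rewrite -[X in X <= _]sqrtr1 ler_wsqrtr// ler1n.
set q := Num.sqrt n%:R in sn1 ta.
have disc (r : seq 'I_n) : uniq r -> exists chi : 'I_n -> bool, forall j t,
    `|\sum_(x <- take t r) g j x * spin (chi x)| <= q / 5.
  move=> ur; have [|chi Hchi] := @prefix_discrepancy R _ m g r _ ur.
    by move=> j i; rewrite spin_norm.
  exists chi => j t; apply: (le_trans (Hchi j t)).
  have -> : q / 5 = 1 / 5 * q by ring.
  apply: discrepancy_le al mn _; first by lra.
  by rewrite -[X in (_ <= X)%N]card_ord -(card_uniqP ur) max_card.
pose P (i : 'I_n) := (i < a)%N.
have cP : #|P| = a.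
  rewrite -sum1_card -[RHS]muln1 -[X in (X * _)%N]card_ord -sum_nat_const.
  by rewrite (big_ord_widen n (fun=> 1%N) an).
have [||||||k [c [ck Hc]]] := @fractional_solution R m n g P _ (1 / 40)
    ((`|kappa| + 2) * q).
- by move=> j i; rewrite /g; case: (G j i); rewrite /spin ?sqrrN expr1n.
- by lra.
- by apply: mulr_ge0; [have := normr_ge0 kappa|]; lra.
- by rewrite cP.
- by rewrite cP.
- move=> y y0; rewrite cP.
  have -> : 2 * (1 / 40) * a%:R * norm2 y = a%:R / 20 * norm2 y by field.
  exact: dual_norm_lower_bound H4 Ha m0 Hz Hx y y0.
have [|d Hd] := @bit_rounding R m n g P (q / 5) k c _ ck.
  move=> S; have [chi Hchi] := disc _ (enum_uniq S); exists chi => j.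
  by have := Hchi j #|S|; rewrite take_oversize -?cardE// big_enum.
pose r := [seq i <- enum 'I_n | ~~ P i].
have ur : uniq r by rewrite filter_uniq// enum_uniq.
have sr : (size r = n - a)%N.
  have e := count_predC P (enum 'I_n); rewrite size_enum_ord in e.
  have {}cP : count P (enum 'I_n) = a.
    by rewrite -sum1_count big_enum_cond sum1_card.
  by apply/eqP; rewrite size_filter -(eqn_add2l a) subnKC// -{1}cP e.
have [chi Hchi] := disc r ur.
pose X : cube n := [ffun i => if P i then d i else chi i].
have [|C CS h] := @cluster_of_flips n (abp_solutions kappa G) X r ur; last first.
  by exists C; rewrite // -sr.
move=> t; rewrite inE; apply/forallP => j.
rewrite /margin mulrC -/q ler_pdivlMr; last by lra.
rewrite sum_flip_seq// (bigID P) /=.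
have -> : \sum_(i | P i) g j i * spin (X i) = \sum_(i | P i) g j i * spin (d i).
  by apply: eq_bigr => i Pi; rewrite ffunE Pi.
have rE u : \sum_(i <- take u r) g j i * spin (X i) =
    \sum_(i <- take u r) g j i * spin (chi i).
  by apply: eq_big_seq => i /mem_take; rewrite mem_filter => /andP[/negbTE Pi _];
    rewrite ffunE Pi.
have -> : \sum_(i | ~~ P i) g j i * spin (X i) =
    \sum_(i <- take (size r) r) g j i * spin (chi i).
  by rewrite -rE take_size big_filter big_enum_cond.
rewrite rE.
have := Hchi j (size r); have := Hchi j t; have := Hc j; have := Hd j.
have : 0 < (2 ^+ k)^-1 :> R by rewrite invr_gt0 exprn_gt0.
have : kappa * q <= `|kappa| * q by rewrite ler_wpM2r ?ler_norm//; lra.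
set A := \sum_(i | P i) _; set B := \sum_(i | P i) _.
set C1 := \sum_(i <- take (size r) r) _; set C2 := \sum_(i <- take t r) _.
move=> kq v0 hAB hA hC2 hC1.
have {}hAB : `|A - B| <= 2 * (q / 5).
  apply: le_trans hAB _; apply: ler_piMr; last by rewrite gerBl ltW.
  by apply: mulr_ge0 => //; lra.
move: hAB hC2 hC1; rewrite !ler_norml => /andP[? ?] /andP[? ?] /andP[? ?]; lra.
Qed.

End AbpCluster.

(** * Random matrices *)

Lemma mean_columns (R : realType) (m n : nat)
    (F : 'I_n -> {ffun 'I_m -> bool} -> R) :
  mean (fun G : 'M[bool]_(m, n) => \prod_i F i [ffun j => G j i]) =
  \prod_i mean (F i).
Proof.
rewrite -mean_prod.
pose h (f : {ffun 'I_n -> {ffun 'I_m -> bool}}) : 'M[bool]_(m, n) :=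
  \matrix_(j, i) f i j.
have hb : bijective h.
  exists (fun G : 'M[bool]_(m, n) => [ffun i => [ffun j => G j i]]) => [f|G].
    by apply/ffunP => i; apply/ffunP => j; rewrite !ffunE mxE.
  by apply/matrixP => j i; rewrite mxE !ffunE.
rewrite /mean -(bij_eq_card hb) (reindex h) /=; last exact: onW_bij.
congr (_ * _); apply: eq_bigr => f _; apply: eq_bigr => i _; congr (F i _).
by apply/ffunP => j; rewrite ffunE mxE.
Qed.

Lemma union_bound (R : realType) (Om I : finType) (E : pred Om) (B : I -> pred Om) :
  (forall G, ~~ E G -> exists z, B z G) ->
  mean (fun G => (~~ E G : nat)%:R) <= \sum_z mean (fun G => (B z G : nat)%:R) :> R.
Proof.
move=> EB; rewrite -mean_sum; apply: le_mean => G.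
have [_|/EB[z Bz]] := boolP (E G); first by apply: sumr_ge0 => *; exact: ler0n.
by rewrite (bigD1 z)//= Bz lerDl sumr_ge0// => *; exact: ler0n.
Qed.

Lemma mean_markov (R : realType) (Om : finType) (E : pred Om) (f : Om -> R) :
  (forall G, E G -> 0 <= f G) ->
  mean (fun G => (E G : nat)%:R) <= mean (fun G => expR (f G)).
Proof.
move=> Ef; apply: le_mean => G; case: (boolP (E G)) => [/Ef h|_]; last exact: expR_ge0.
by apply: le_trans (expR_ge1Dx _); rewrite lerDl.
Qed.

(* [11 v >= 9 v^2 - v^4] turns the bounds on the second and fourth moments into
   a lower bound for the mean of [v = |<z, g>| / |z|]. *)
Lemma mean_expRN_column (R : realType) (m : nat) (z : 'I_m -> R) :
  0 < norm2 z ->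
  mean (fun g : {ffun 'I_m -> bool} =>
    expR (- (`|\sum_j spin (g j) * z j| / (4 * norm2 z)))) <= expR (- (7 / 100)).
Proof.
move=> u0; set u := norm2 z in u0 *.
have [E2 E4 _] := moments z (index_enum_uniq 'I_m).
rewrite -sqr_norm2 -/u in E2 E4.
pose V (g : {ffun 'I_m -> bool}) : R := \sum_j z j * spin (g j).
rewrite -/V in E2 E4.
(* Coefficients from [exp (- v / 4) <= 1 - v / 4 + v ^ 2 / 16] and [v >= (9 * v ^ 2 - v ^ 4) / 11].
   The mean is then at most [1 + 1 / 16 - 6 / 44 <= 1 - 7 / 100]. *)
apply: (@le_trans _ _ (mean (fun g => (1 + (1 / 16 - 9 / 44) * u ^- 2 * V g ^+ 2)
    + (1 / 44 * u ^- 4) * V g ^+ 4))).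
  apply: le_mean => g.
  rewrite (eq_bigr (fun j => z j * spin (g j))); last by move=> j _; rewrite mulrC.
  rewrite -/(V g).
  pose v := `|V g| / u.
  have v0 : 0 <= v by rewrite divr_ge0// ltW.
  have -> : `|V g| / (4 * u) = v / 4 by rewrite /v; field; exact: lt0r_neq0.
  have V2 : u ^- 2 * V g ^+ 2 = v ^+ 2.
    by rewrite /v expr_div_n real_normK ?num_real// mulrC.
  have V4 : u ^- 4 * V g ^+ 4 = v ^+ 4.
    have -> : v ^+ 4 = (v ^+ 2) ^+ 2 by ring.
    by rewrite -V2; field; exact: lt0r_neq0.
  rewrite -[_ * V g ^+ 2]mulrA V2 -[_ * V g ^+ 4]mulrA V4.
  have e1 : expR (- (v / 4)) * (1 + v / 4) <= 1.
    have := expR_ge1Dx (v / 4); have := expR_gt0 (- (v / 4)).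
    have : expR (- (v / 4)) * expR (v / 4) = 1 by rewrite -expRD addNr expR0.
    move: (expR (v / 4)) (expR (- (v / 4))) => e' e; nra.
  have e2 : expR (- (v / 4)) <= 1 - v / 4 + v ^+ 2 / 16.
    have p : 0 < 1 + v / 4 by lra.
    rewrite -(ler_pM2r p); apply: (le_trans e1).
    have := mulr_ge0 (mulr_ge0 v0 v0) v0; nra.
  (* The square is centered at [7 / 4], close to the minimizer [sqrt 3]. *)
  have e3 : 0 <= v ^+ 3 - 9 * v + 11.
    have -> : v ^+ 3 - 9 * v + 11 =
      (v - 7 / 4) ^+ 2 * (v + 7 / 2) + 3 / 16 * v + 9 / 32 by field.
    have : 0 <= (v - 7 / 4) ^+ 2 * (v + 7 / 2) by rewrite mulr_ge0 ?sqr_ge0//; lra.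
    lra.
  have := mulr_ge0 v0 e3; lra.
rewrite !meanD !meanZ mean_cst ?card_cube_gt0// E2.
apply: (le_trans _ (expR_ge1Dx _)).
have -> : (1 / 16 - 9 / 44) * u ^- 2 * u ^+ 2 = 1 / 16 - 9 / 44 :> R.
  by field; exact: lt0r_neq0.
have : 1 / 44 * u ^- 4 * mean (fun g => V g ^+ 4) <= 3 / 44.
  have -> : 3 / 44 = 1 / 44 * u ^- 4 * (3 * (u ^+ 2) ^+ 2) :> R.
    by field; exact: lt0r_neq0.
  rewrite ler_wpM2l// mulr_ge0 ?invr_ge0 ?exprn_ge0 ?(ltW u0)//; lra.
lra.
Qed.

(** Chernoff bound over [a] independent columns: [1 / 20 - 7 / 100 = - 1 / 50]. *)
Lemma mean_small_columns (R : realType) (m n a : nat) (z : 'I_m -> R) :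
  (a <= n)%N -> 0 < norm2 z ->
  mean (fun G : 'M[bool]_(m, n) =>
    (~~ (a%:R / 5 * norm2 z <=
       \sum_(i < n | (i < a)%N) `|\sum_j spin (G j i) * z j|) : nat)%:R) <=
  expR (- (a%:R / 50)) :> R.
Proof.
move=> an u0; set u := norm2 z in u0 *.
pose S (G : 'M[bool]_(m, n)) i : R := `|\sum_j spin (G j i) * z j|.
apply: (@le_trans _ _ (mean (fun G : 'M[bool]_(m, n) =>
    expR (a%:R / 20 - \sum_(i < n | (i < a)%N) S G i / (4 * u))))).
  apply: mean_markov => G; rewrite -ltNge -/(S G) -mulr_suml => h.
  rewrite subr_ge0 ler_pdivrMr ?mulr_gt0//.
  have -> : a%:R / 20 * (4 * u) = a%:R / 5 * u by field.
  exact: ltW.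
pose F (i : 'I_n) (g : {ffun 'I_m -> bool}) : R :=
  if (i < a)%N then expR (- (`|\sum_j spin (g j) * z j| / (4 * u))) else 1.
rewrite (eq_mean (g := fun G : 'M[bool]_(m, n) => expR (a%:R / 20) *
    \prod_i F i [ffun j => G j i])); last first.
  move=> G; rewrite expRD -sumrN expR_sum; congr (_ * _).
  rewrite big_mkcond /=; apply: eq_bigr => i _; rewrite /F; case: ifP => // _.
  congr expR; congr (- _); congr (_ / _); congr `| _ |.
  by apply: eq_bigr => j _; rewrite ffunE.
rewrite meanZ mean_columns.
have : \prod_i mean (F i) <= \prod_(i < n | (i < a)%N) expR (- (7 / 100)) :> R.
  rewrite [X in _ <= X]big_mkcond /=; apply: ler_prod => i _.
  have [ia|ia] := ltnP i a; rewrite /F.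
    rewrite ia mean_expRN_column// andbT.
    rewrite -[X in X <= _](@mean_cst R {ffun 'I_m -> bool}) ?card_cube_gt0//.
    by apply: le_mean => g; exact: expR_ge0.
  by rewrite ltnNge ia /= mean_cst ?card_cube_gt0 ?ler01 ?lexx.
move=> /(ler_wpM2l (expR_ge0 (a%:R / 20))) /le_trans; apply.
rewrite -expR_sum -expRD ler_expR sumr_const.
have -> : #|(fun i : 'I_n => i < a)%N| = a.
  rewrite -sum1_card -[RHS]muln1 -[X in (X * _)%N](card_ord a) -sum_nat_const.
  by rewrite (big_ord_widen n (fun=> 1%N) an).
rewrite -[_ *+ a]mulr_natl; have := ler0n R a; lra.
Qed.

(** Uses [exp x <= 1 / (1 - x) <= 1 + x + 2 * x ^ 2] for [|x| <= 1 / 2]; the linear terms cancel. *)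
Lemma cosh_le (R : realType) (t : R) : `|t| <= 1 / 2 ->
  (expR t + expR (- t)) / 2 <= expR (2 * t ^+ 2).
Proof.
have key (x : R) : -(1 / 2) <= x -> x <= 1 / 2 -> expR x <= 1 + x + 2 * x ^+ 2.
  move=> x1 x2; have p : 0 < 1 - x by lra.
  have h : expR x * (1 - x) <= 1.
    have := expR_ge1Dx (- x); have := expR_gt0 x.
    have : expR x * expR (- x) = 1 by rewrite -expRD subrr expR0.
    move: (expR x) (expR (- x)) => e e'; nra.
  rewrite -(ler_pM2r p); apply: (le_trans h).
  have : 0 <= x ^+ 2 * (1 - 2 * x) by rewrite mulr_ge0 ?sqr_ge0//; lra.
  lra.
rewrite ler_norml => /andP[t1 t2].
have h1 := key t t1 t2; have h2 : expR (- t) <= 1 + (- t) + 2 * (- t) ^+ 2.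
  by apply: key; lra.
apply: (le_trans _ (expR_ge1Dx _)); rewrite sqrrN in h2; lra.
Qed.

(** Exponential Markov with parameter [1 / sqrt m], at most [1 / 2] as [m >= 4]. Each of the [m * n]
    entries contributes at most [exp (2 / m)], in total [exp (2 * n)] against [exp (- 5 * n)]. *)
Lemma mean_large_form (R : realType) (m n : nat) (x : cube n) (s : cube m) :
  (4 <= m)%N ->
  mean (fun G : 'M[bool]_(m, n) =>
    ((5 * n%:R * Num.sqrt m%:R <
      \sum_j spin (s j) * \sum_i spin (G j i) * spin (x i) :> R)%R : nat)%:R) <=
  expR (- (3 * n%:R)) :> R.
Proof.
move=> m4.
have m0 : 0 < m%:R :> R by rewrite ltr0n (leq_trans _ m4).
set q : R := Num.sqrt m%:R.
have q0 : 0 < q by rewrite sqrtr_gt0.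
have q2 : q ^+ 2 = m%:R by rewrite sqr_sqrtr// ltW.
have q4 : 2 <= q.
  have -> : 2 = Num.sqrt (2 ^+ 2) :> R by rewrite sqrtr_sqr ger0_norm.
  by rewrite ler_wsqrtr// -natrX ler_nat.
apply: (@le_trans _ _ (mean (fun G : 'M[bool]_(m, n) =>
   expR ((\sum_j spin (s j) * \sum_i spin (G j i) * spin (x i)) / q - 5 * n%:R)))).
  apply: mean_markov => G h; rewrite subr_ge0 ler_pdivlMr//; exact: ltW.
pose F (i : 'I_n) (g : {ffun 'I_m -> bool}) : R :=
  \prod_j expR (spin (s j) * spin (x i) / q * spin (g j)).
rewrite (eq_mean (g := fun G : 'M[bool]_(m, n) => expR (- (5 * n%:R)) *
    \prod_i F i [ffun j => G j i])); last first.
  move=> G; rewrite expRD mulrC; congr (_ * _).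
  rewrite /F -(eq_bigr _ (fun i _ => expR_sum _ _ _)) -expR_sum; congr expR.
  rewrite exchange_big /= mulr_suml; apply: eq_bigr => j _.
  rewrite mulr_sumr mulr_suml; apply: eq_bigr => i _; rewrite ffunE; ring.
rewrite meanZ mean_columns.
have : \prod_i mean (F i) <= \prod_(i in 'I_n) expR 2 :> R.
  apply: ler_prod => i _.
  rewrite (mean_prod (fun j b => expR (spin (s j) * spin (x i) / q * spin b))).
  apply/andP; split.
    apply: prodr_ge0 => j _; rewrite mean_bool.
    by rewrite divr_ge0// addr_ge0// expR_ge0.
  apply: (@le_trans _ _ (\prod_(j < m) expR (2 * q ^- 2))); last first.
    rewrite -expR_sum ler_expR sumr_const card_ord -[_ *+ m]mulr_natr q2.
    by rewrite -mulrA mulVf ?mulr1// gt_eqF.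
  apply: ler_prod => j _; rewrite mean_bool; apply/andP; split.
    by rewrite divr_ge0// addr_ge0// expR_ge0.
  have e : spin (s j) * spin (x i) / q = q^-1 \/ spin (s j) * spin (x i) / q = - q^-1.
    case: (s j); case: (x i); rewrite /spin ?mul1r ?mulN1r ?opprK ?mulNr ?mul1r;
      by [left|right].
  have qi : `|q^-1| <= 1 / 2.
    by rewrite ger0_norm ?invr_ge0 ?(ltW q0)// div1r lef_pV2 ?posrE.
  have h := cosh_le qi; rewrite exprVn in h.
  have -> : spin true = 1 :> R by [].
  have -> : spin false = -1 :> R by [].
  rewrite mulr1 mulrN1.
  by case: e => ->; [exact: h|rewrite opprK addrC; exact: h].
move=> /(ler_wpM2l (expR_ge0 (- (5 * n%:R)))) /le_trans; apply.
rewrite -expR_sum -expRD ler_expR sumr_const card_ord -[_ *+ n]mulr_natl; lra.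
Qed.

Lemma expRN1_le (R : realType) : expR (-1) <= 1 / 2 :> R.
Proof.
rewrite expRN div1r lef_pV2 ?posrE ?expR_gt0//.
by have := expR_ge1Dx (1 : R); lra.
Qed.

Lemma card_cube_le (R : realType) (n : nat) : #|{: cube n}|%:R <= expR n%:R :> R.
Proof.
rewrite card_ffun card_bool card_ord natrX -[n%:R]mulr1 expRM_natl lerXn2r ?nnegrE ?expR_ge0//.
by have := expR_ge1Dx (1 : R); lra.
Qed.

Lemma sum_expRN_le2 (R : realType) (N : nat) : \sum_(k < N) expR (- k%:R) <= 2 :> R.
Proof.
suff : \sum_(k < N) expR (- k%:R) <= 2 - 2 * expR (- N%:R) :> R.
  by have := expR_gt0 (- N%:R : R); lra.
elim: N => [|N IH]; first by rewrite big_ord0 oppr0 expR0; lra.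
rewrite big_ord_recr /=.
have -> : expR (- N.+1%:R) = expR (- N%:R) * expR (-1) :> R.
  by rewrite -expRD -natr1 opprD.
have := ler_wpM2l (expR_ge0 (- N%:R : R)) (expRN1_le R); lra.
Qed.

(** * Typical properties of the matrix, by union bounds *)

Section GoodMatrix.
Variables (R : realType) (H : R) (m n a : nat).

Let N := (Num.truncn (H * m%:R)).+1.

Definition spreading (G : 'M[bool]_(m, n)) : bool :=
  [forall z : {ffun 'I_m -> 'I_N},
    ((0 < \sum_j z j)%N && ((\sum_j z j)%:R <= H * m%:R)) ==>
    (a%:R / 5 * norm2 (fun j => (z j)%:R : R) <=
     \sum_(i < n | (i < a)%N) `|\sum_j spin (G j i) * (z j)%:R|)].

(** The signs [s] linearize the absolute values of the row sums, so that a union bound over pairs of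
    sign vectors applies. *)
Definition bounded_form (G : 'M[bool]_(m, n)) : bool :=
  [forall x : cube n, [forall s : cube m,
    \sum_j spin (s j) * \sum_i spin (G j i) * spin (x i) <=
    5 * n%:R * Num.sqrt m%:R :> R]].

Lemma spreadingP (G : 'M[bool]_(m, n)) : spreading G ->
  forall z : 'I_m -> nat, (0 < \sum_j z j)%N -> (\sum_j z j)%:R <= H * m%:R ->
    a%:R / 5 * norm2 (fun j => (z j)%:R : R) <=
    \sum_(i < n | (i < a)%N) `|\sum_j spin (G j i) * (z j)%:R|.
Proof.
move=> /forallP good z z0 zH.
have zN j : (z j < N)%N.
  rewrite ltnS; apply: leq_trans (le_truncn zH); rewrite natrK.
  by rewrite (bigD1 j)//= leq_addr.
have := good [ffun j => Ordinal (zN j)].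
under eq_bigr do rewrite ffunE /=.
rewrite z0 zH /=.
have -> : norm2 (fun j => ([ffun j => Ordinal (zN j)] j : nat)%:R : R) =
    norm2 (fun j => (z j)%:R).
  by congr Num.sqrt; apply: eq_bigr => j _; rewrite ffunE.
move=> /le_trans; apply; rewrite le_eqVlt; apply/orP; left; apply/eqP.
by apply: eq_bigr => i _; congr `| _ |; apply: eq_bigr => j _; rewrite ffunE.
Qed.

Lemma bounded_formP (G : 'M[bool]_(m, n)) : bounded_form G ->
  forall x : cube n,
    \sum_j `|\sum_i spin (G j i) * spin (x i)| <= 5 * n%:R * Num.sqrt m%:R :> R.
Proof.
move=> /forallP good x; have /forallP good' := good x.
apply: le_trans (good' [ffun j => 0 <= \sum_i spin (G j i) * spin (x i) :> R]).
apply: ler_sum => j _; rewrite ffunE.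
set S := \sum_i _; case: (lerP 0 S) => S0; rewrite /spin /=.
  by rewrite mul1r ger0_norm.
by rewrite mulN1r ltr0_norm.
Qed.

(** The admissible [z] are counted with the weight [exp (H * m - \sum_j z j) >= 1], which factors
    over coordinates into at most [exp (H * m)] times [2 ^ m]. *)
Lemma mean_not_spreading : 0 <= H -> (a <= n)%N ->
  mean (fun G => (~~ spreading G : nat)%:R) <=
  expR ((H + 1) * m%:R - a%:R / 50) :> R.
Proof.
move=> H0 an.
pose B (z : {ffun 'I_m -> 'I_N}) : pred 'M[bool]_(m, n) := fun G =>
  ((0 < \sum_j z j)%N && ((\sum_j z j)%:R <= H * m%:R)) &&
  ~~ (a%:R / 5 * norm2 (fun j => (z j)%:R : R) <=
     \sum_(i < n | (i < a)%N) `|\sum_j spin (G j i) * (z j)%:R|).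
apply: (@le_trans _ _ (\sum_z mean (fun G => (B z G : nat)%:R))).
  apply: union_bound => G; rewrite negb_forall => /existsP[z].
  by rewrite negb_imply => h; exists z.
apply: (@le_trans _ _ (\sum_(z : {ffun 'I_m -> 'I_N})
    expR (H * m%:R - a%:R / 50) * \prod_j expR (- (z j)%:R))).
  apply: ler_sum => z _.
  rewrite -expR_sum -expRD /B.
  case: (boolP (_ && _)) => [/andP[z0 zH]|_] /=; last first.
    by rewrite mean_cst ?expR_ge0// card_mx card_bool expn_gt0.
  apply: (le_trans (mean_small_columns an _)).
    rewrite sqrtr_gt0 lt0r; apply/andP; split; last first.
      by apply: sumr_ge0 => *; exact: sqr_ge0.
    apply: contraTneq z0 => z0; rewrite -leqNgt leqn0 sum_nat_eq0.
    apply/forallP => j; apply/eqP.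
    have := psumr_eq0P (fun j _ => sqr_ge0 ((z j)%:R : R)) z0 (i := j) isT.
    by move/eqP; rewrite sqrf_eq0 pnatr_eq0 => /eqP.
  by rewrite ler_expR sumrN -natr_sum; lra.
rewrite -mulr_sumr -(bigA_distr_bigA (fun _ (k : 'I_N) => expR (- k%:R))) /=.
have : \prod_(j < m) \sum_(k < N) expR (- k%:R) <= expR m%:R :> R.
  rewrite -[m%:R]mulr1 expRM_natl -[m in expR 1 ^+ m]card_ord -prodr_const.
  apply: ler_prod => j _; rewrite sumr_ge0 => [|k _]; last exact: expR_ge0.
  by apply: le_trans (sum_expRN_le2 _ _) _; have := expR_ge1Dx (1 : R); lra.
move=> /(ler_wpM2l (expR_ge0 (H * m%:R - a%:R / 50))) /le_trans; apply.
by rewrite -expRD ler_expR; lra.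
Qed.

(** At most [exp (n + m) <= exp (2 * n)] pairs of sign vectors, each of probability at most
    [exp (- 3 * n)]. *)
Lemma mean_not_bounded_form : (4 <= m)%N -> (m <= n)%N ->
  mean (fun G => (~~ bounded_form G : nat)%:R) <= expR (- n%:R) :> R.
Proof.
move=> m4 mn.
pose B (p : cube n * cube m) : pred 'M[bool]_(m, n) := fun G =>
  (5 * n%:R * Num.sqrt m%:R <
    \sum_j spin (p.2 j) * \sum_i spin (G j i) * spin (p.1 i) :> R).
apply: (@le_trans _ _ (\sum_p mean (fun G => (B p G : nat)%:R))).
  apply: union_bound => G; rewrite negb_forall => /existsP[x].
  by rewrite negb_forall => /existsP[s]; rewrite -ltNge => h; exists (x, s).
apply: (@le_trans _ _ (\sum_(p : cube n * cube m) expR (- (3 * n%:R)))).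
  by apply: ler_sum => p _; exact: mean_large_form.
rewrite sumr_const -[_ *+ _]mulr_natl card_prod natrM.
have h : #|{: cube n}|%:R * #|{: cube m}|%:R <= expR n%:R * expR m%:R :> R.
  by apply: ler_pM; rewrite ?ler0n ?card_cube_le.
apply: (le_trans (ler_wpM2r (expR_ge0 _) h)).
have mnR : m%:R <= n%:R :> R by rewrite ler_nat.
by rewrite -!expRD ler_expR; lra.
Qed.

End GoodMatrix.

(** * High-probability statements *)

Lemma Prob_le1 (R : realType) m n (E : pred 'M[bool]_(m, n)) : Prob R E <= 1.
Proof.
rewrite Prob_mean -[X in _ <= X](@mean_cst R 'M[bool]_(m, n)).
  by apply: le_mean => G; case: (E G); rewrite ?ler01 ?lexx.
by rewrite card_mx card_bool expn_gt0.
Qed.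

Lemma whp_of_lower_bound (R : realType) (alpha c b : R)
    (E : forall n, pred 'M[bool]_(nb_constraints alpha n, n)) :
  0 < c ->
  (forall n, b < n%:R ->
    1 - expR (- (c * n%:R)) - expR (- n%:R) <= Prob R (@E n)) ->
  with_high_probability alpha E.
Proof.
move=> c0 low; apply/cvgrPdist_le => e e0; near=> n.
have n0 : 0 < n%:R :> R by near: n; exact: nbhs_infty_gtr.
have nb : b < n%:R by near: n; exact: nbhs_infty_gtr.
have n1 : 2 / (c * e) < n%:R by near: n; exact: nbhs_infty_gtr.
have n2 : 2 / e < n%:R by near: n; exact: nbhs_infty_gtr.
rewrite ger0_norm ?subr_ge0 ?Prob_le1//.
have h := low n nb.
have cn : 0 < c * n%:R by rewrite mulr_gt0.
have h1 := inv_ge_expRN cn; have h2 := inv_ge_expRN n0.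
have h3 : (c * n%:R)^-1 <= e / 2.
  have -> : e / 2 = (2 / e)^-1 by rewrite invf_div.
  have -> : 2 / e = c * (2 / (c * e)) by field; rewrite !lt0r_neq0.
  by rewrite lef_pV2 ?posrE// ?(ler_pM2l c0) ?(ltW n1)// mulr_gt0// divr_gt0// mulr_gt0.
have h4 : n%:R^-1 <= e / 2.
  have -> : e / 2 = (2 / e)^-1 by rewrite invf_div.
  by rewrite lef_pV2 ?posrE ?divr_gt0// ltW.
lra.
Unshelve. all: by end_near.
Qed.

(** Here [a] is the floor of [delta * n], at least [delta * n / 2]; [H = 200 / delta] gives
    [100 * n <= H * a]. The union bound for [spreading] costs [(H + 1) * m <= delta * n / 200], half
    of the gain [a / 50 >= delta * n / 100]. *)
Lemma abp_probability (R : realType) (kappa eps alpha delta H : R) (n : nat) :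
  0 < alpha -> 0 < delta -> delta <= eps -> delta <= 1 / 2 -> H = 200 / delta ->
  alpha <= 1 -> 1500 * alpha <= (1 / 5 / 400) ^+ 4 ->
  (H + 1) * alpha <= delta / 200 ->
  alpha <= (delta / (80 * (`|kappa| + 2))) ^+ 2 ->
  2 < delta * n%:R -> 5 < alpha * n%:R ->
  1 - expR (- (delta / 200 * n%:R)) - expR (- n%:R) <=
  Prob R (fun G : 'M[bool]_(nb_constraints alpha n, n) =>
    [exists C : {set cube n}, is_cluster (abp_solutions kappa G) C &&
       ((1 - eps) * n%:R <= (diameter C)%:R)]).
Proof.
move=> a0 d0 de d2 HE al1 al2 al3 al4 dn an.
set m := nb_constraints alpha n; pose a := Num.truncn (delta * n%:R).
have mle : m%:R <= alpha * n%:R by apply: nb_constraints_le; exact: ltW.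
have m4 : (4 <= m)%N.
  by rewrite truncn_ge_nat; lra.
have nge0 : 0 <= n%:R :> R by [].
have mn : (m <= n)%N.
  rewrite -(ler_nat R); apply: (le_trans mle).
  by have := ler_wpM2r nge0 al1; lra.
have ale : a%:R <= delta * n%:R by rewrite truncn_le; lra.
have age : delta * n%:R / 2 <= a%:R.
  by have := truncnS_gt (delta * n%:R); rewrite -natr1 -/a; lra.
have a1 : (0 < a)%N by rewrite -(ltr_nat R); lra.
have alen : (a <= n)%N.
  by rewrite -(ler_nat R); have := ler_wpM2r nge0 d2; lra.
have n0 : (0 < n)%N by apply: leq_trans alen.
have m0 : (0 < m)%N by apply: leq_trans m4.
have Hd : H * delta = 200 by rewrite HE divfK// gt_eqF.
have H4 : 4 <= H.
  by rewrite HE ler_pdivlMr//; lra.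
have Ha : 100 * n%:R <= H * a%:R.
  have : H * (delta * n%:R / 2) <= H * a%:R by apply: ler_wpM2l => //; lra.
  by rewrite mulrA mulrA Hd; lra.
have K0 : 0 < `|kappa| + 2 by have := normr_ge0 kappa; lra.
have ta : (`|kappa| + 2) * Num.sqrt n%:R * Num.sqrt m%:R <= 1 / 40 * a%:R.
  set K := `|kappa| + 2 in K0 al4 *.
  have hm : Num.sqrt m%:R <= delta / (80 * K) * Num.sqrt n%:R.
    have dK : 0 <= delta / (80 * K) by rewrite divr_ge0 ?mulr_ge0 ?ltW.
    rewrite -[X in _ <= X * _](ger0_norm dK) -sqrtr_sqr -sqrtrM ?sqr_ge0//.
    by rewrite ler_wsqrtr//; apply: (le_trans mle); exact: ler_wpM2r.
  have KS : 0 <= K * Num.sqrt n%:R by rewrite mulr_ge0 ?sqrtr_ge0// ltW.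
  apply: (le_trans (ler_wpM2l KS hm)).
  have -> : K * Num.sqrt n%:R * (delta / (80 * K) * Num.sqrt n%:R) =
      delta / 80 * Num.sqrt n%:R ^+ 2 by field; exact: lt0r_neq0.
  by rewrite sqr_sqrtr//; lra.
have H0 : 0 <= H by lra.
have bad1 : mean (fun G : 'M[bool]_(m, n) => (~~ spreading H a G : nat)%:R) <=
    expR (- (delta / 200 * n%:R)) :> R.
  apply: le_trans (mean_not_spreading m H0 alen) _; rewrite ler_expR.
  have h1 : (H + 1) * m%:R <= (H + 1) * (alpha * n%:R).
    by apply: ler_wpM2l => //; lra.
  have h2 := ler_wpM2r nge0 al3.
  lra.
have bad2 := @mean_not_bounded_form R m n m4 mn.
rewrite Prob_mean.
pose E (G : 'M[bool]_(m, n)) := [exists C : {set cube n},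
  is_cluster (abp_solutions kappa G) C && ((1 - eps) * n%:R <= (diameter C)%:R)].
rewrite -[mean _]/(mean (fun G => (E G : nat)%:R)).
have : mean (fun _ : 'M[bool]_(m, n) => 1 : R) <= mean (fun G => (E G : nat)%:R +
    ((~~ spreading H a G : nat)%:R + (~~ bounded_form R G : nat)%:R)).
  apply: le_mean => G.
  case: (boolP (spreading H a G)) => [sp|_] /=; last first.
    by rewrite addrCA lerDl addr_ge0 ?ler0n.
  case: (boolP (bounded_form R G)) => [bf|_] /=; last first.
    by rewrite add0r lerDr ler0n.
  have [C CS diam] := abp_cluster n0 m0 a1 alen mle al2 H4 Ha ta
    (spreadingP sp) (bounded_formP bf).
  have -> : E G.
    apply/existsP; exists C; rewrite CS /=.
    have : (n - a)%:R <= (diameter C)%:R :> R by rewrite ler_nat.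
    apply: le_trans; rewrite natrB//.
    by have := ler_wpM2r nge0 de; lra.
  by rewrite !addr0.
rewrite mean_cst ?card_mx ?card_bool ?expn_gt0// !meanD; lra.
Qed.

Theorem theorem2p1 (R : realType) :
  (forall kappa : R, 0 < kappa ->
     exists alpha_o : R, 0 < alpha_o /\
       forall alpha : R, 0 < alpha -> alpha < alpha_o ->
         with_high_probability alpha (fun n G =>
           [exists C : {set cube n},
              is_cluster (sbp_solutions kappa G) C && (diameter C == n)]))
  /\
  (forall kappa eps : R, 0 < eps ->
     exists alpha_o : R, 0 < alpha_o /\
       forall alpha : R, 0 < alpha -> alpha < alpha_o ->
         with_high_probability alpha (fun n G =>
           [exists C : {set cube n},
              is_cluster (abp_solutions kappa G) C &&
              ((1 - eps) * n%:R <= (diameter C)%:R)])).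
Proof.
split=> [kappa k0|kappa eps e0].
  exists ((kappa / 3 / 400) ^+ 4 / 1500); split.
    have h15 : 0 < 1500 :> R by lra.
    by apply: (divr_gt0 _ h15); apply: exprn_gt0; lra.
  move=> alpha a0; rewrite ltr_pdivlMr ?ltr0n// mulrC => /ltW a1.
  rewrite /with_high_probability.
  (* Every matrix has the cluster, so the probability is constantly 1. *)
  have E1 n (G : 'M[bool]_(nb_constraints alpha n, n)) : [exists C : {set cube n},
      is_cluster (sbp_solutions kappa G) C && (diameter C == n)].
    have [C CS Cn] := sbp_cluster G k0 a1 (nb_constraints_le n (ltW a0)).
    by apply/existsP; exists C; rewrite CS Cn eqxx.
  rewrite (_ : (fun n => _) = fun=> 1); first exact: cvg_cst.
  apply/funext => n; rewrite Prob_mean.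
  rewrite (eq_mean (g := fun _ => 1)) => [|G]; last by rewrite E1.
  by rewrite mean_cst// card_mx card_bool expn_gt0.
pose delta := Num.min eps (1 / 2); pose H := 200 / delta.
have d0 : 0 < delta by rewrite lt_min e0 divr_gt0.
have de : delta <= eps by rewrite ge_min lexx.
have d2 : delta <= 1 / 2 by rewrite ge_min lexx orbT.
have H0 : 0 < H + 1 by rewrite addr_gt0// divr_gt0 ?ltr0n.
have K0 : 0 < `|kappa| + 2 by have := normr_ge0 kappa; lra.
pose b1 : R := (1 / 5 / 400) ^+ 4 / 1500.
pose b2 : R := delta / 200 / (H + 1).
pose b3 : R := (delta / (80 * (`|kappa| + 2))) ^+ 2.
have b10 : 0 < b1.
  have h15 : 0 < 1500 :> R by lra.
  by apply: (divr_gt0 _ h15); apply: exprn_gt0; lra.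
have b20 : 0 < b2 by apply: (divr_gt0 _ H0); lra.
have b30 : 0 < b3 by rewrite exprn_gt0// divr_gt0// mulr_gt0 ?ltr0n.
(* The four bounds serve [m <= n], the discrepancy on all columns, the union bound over integer
   vectors, and the size of the fractional margins. *)
exists (Num.min 1 (Num.min b1 (Num.min b2 b3))); split.
  by rewrite !lt_min ltr01 b10 b20.
move=> alpha a0; rewrite !lt_min => /and4P[/ltW a1 a2 a3 /ltW a4].
apply: (@whp_of_lower_bound R alpha (delta / 200) (2 / delta + 5 / alpha)).
  by rewrite divr_gt0 ?ltr0n.
move=> n nb.
have p2 : 0 < 2 / delta by rewrite divr_gt0.
have p5 : 0 < 5 / alpha by rewrite divr_gt0 ?ltr0n.
apply: (@abp_probability R kappa eps alpha delta H n) => //.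
- by move: a2; rewrite ltr_pdivlMr ?ltr0n// mulrC => /ltW.
- by move: a3; rewrite ltr_pdivlMr// mulrC => /ltW.
- by rewrite mulrC -ltr_pdivrMr//; lra.
- by rewrite mulrC -ltr_pdivrMr//; lra.
Qed.
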